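(* The Jacobi Bound Conjecture holds in the linear case: let $K$ be a differential field of characteristic zero, and let $u_1,\ldots,u_n\in K\{x_1,\ldots,x_n\}$ be linear differential polynomials. Let $\Sigma_1$ be an irreducible component of $\Sigma=\operatorname{Spec}K\{x_1,\ldots,x_n\}/[u_1,\ldots,u_n]$. If $\dim_K(\Sigma_1)<\infty$, then $\dim_K(\Sigma_1)\le J(u_1,\ldots,u_n)$.
   Context: $K\{x_1,\ldots,x_n\}$ is the ring of differential polynomials over the ordinary differential field $(K,\partial)$, i.e. the polynomial ring in the $x_j^{(r)}$, $r\ge 0$, with $\partial x_j^{(r)}=x_j^{(r+1)}$. A differential polynomial is linear if it has total degree at most $1$ in the variables $x_j^{(r)}$ (coefficients in $K$, a constant term in $K$ allowed). $[u_1,\ldots,u_n]$ is the differential ideal generated by the $u_i$. Irreducible components correspond to minimal primes $P$ over this ideal, and $\dim_K(\Sigma_1)=\operatorname{trdeg}_K\kappa(P)$, where $\kappa(P)=\operatorname{Frac}(K\{x_1,\ldots,x_n\}/P)$. $\operatorname{ord}^{\partial}_{x_j}(u)=\max\{r\ge 0:\partial u/\partial x_j^{(r)}\ne0\}$, where the maximum of the empty set is $-\infty$ in the strong convention and $0$ in the weak convention. The Jacobi bound is $J(u_1,\ldots,u_n)=\max_{\rho\in S_n}\sum_{i=1}^n\operatorname{ord}^{\partial}_{x_{\rho(i)}}(u_i)$ with $-\infty+a=-\infty$. The Jacobi Bound Conjecture is called strong or weak according to the convention used; the strong form implies the weak form. *)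

(* Defs.v *)
From HB Require Import structures.
From mathcomp Require Import all_boot all_order all_algebra all_fingroup.
From mathcomp Require Import finmap.
From mathcomp.multinomials Require Import monalg.
From mathcomp Require Import boolp constructive_ereal.

Set Implicit Arguments.
Unset Strict Implicit.
Unset Printing Implicit Defensive.

Import Order.TTheory GRing.Theory Num.Theory.

Local Open Scope ring_scope.

Definition is_derivation (R : pzRingType) (d : R -> R) : Prop :=
  (forall x y, d (x + y) = d x + d y) /\
  (forall x y, d (x * y) = d x * y + x * d y).

Lemma leibniz_sum (R : pzRingType) (d : R -> R) (I : Type) (s t : seq I)
    (f g : I -> R) :
  d 0 = 0 -> {morph d : x y / x + y} ->
  (forall i j, d (f i * g j) = d (f i) * g j + f i * d (g j)) ->
  let x := \sum_(i <- s) f i in let y := \sum_(j <- t) g j in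
  d (x * y) = d x * y + x * d y.
Proof.
move=> d0 dD h /=.
have dsum := big_morph d dD d0.
rewrite !dsum !mulr_suml dsum -big_split /=; apply: eq_bigr => i _.
rewrite !mulr_sumr dsum -big_split /=; apply: eq_bigr => j _; exact: h.
Qed.

(** * Differential polynomials *)

(* The variable (j, r) stands for x_j^(r), with j counted from 0. *)
Notation dvar n := ('I_n * nat)%type (only parsing).

(* K{x_1, ..., x_n} *)
Notation dpoly K n := {malg K[{cmonom dvar n}]}.

Section DiffPoly.
Variables (K : fieldType) (n : nat).
Implicit Types (u : dpoly K n) (v : dvar n) (m : {cmonom dvar n}).

Definition dX v : dpoly K n := << ucm v >>.

Definition vnext v : dvar n := (v.1, v.2.+1).

Definition pderiv v u : dpoly K n :=
  \sum_(m <- msupp u) << u@_m *+ m v *g divcm m (ucm v) >>.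

(* The derivation of K{x_1, ..., x_n} extending delta and sending x_j^(r) to
   x_j^(r+1); see [ddiff_derivation], [ddiffC] and [ddiffX]. *)
Definition ddiff (delta : K -> K) u : dpoly K n :=
  \sum_(m <- msupp u)
    (<< delta u@_m *g m >> +
     \sum_(v <- finsupp m)
       << u@_m *+ m v *g mulcm (divcm m (ucm v)) (ucm (vnext v)) >>).

Definition dlinear u : Prop := {in msupp u, forall m, (mdeg m <= 1)%N}.

(* A strict bound on the r such that some x_j^(r) occurs in u. *)
Definition dbound u : nat :=
  \max_(m <- msupp u) \max_(v <- finsupp m) v.2.+1.

Lemma mcoeff_pderiv v u m :
  (pderiv v u)@_m = u@_(mulcm m (ucm v)) *+ (m v).+1.
Proof.
rewrite /pderiv raddf_sum /=.
pose m' := mulcm m (ucm v).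
have m'v : m' v = (m v).+1 by rewrite mulcmE ucmE eqxx addn1.
have hm (k : {cmonom dvar n}) : k v != 0%N -> (divcm k (ucm v) == m) = (k == m').
  move=> kv; apply/eqP/eqP => [em|->]; apply/eqP/cmP => i.
    rewrite /m' -em mulcmE divcmE !ucmE; case: eqP => [<-|_] /=; last by rewrite subn0 addn0.
    by rewrite subnK // lt0n.
  by rewrite divcmE mulcmE addnK.
rewrite (eq_bigr (fun k : {cmonom dvar n} => if k == m' then u@_m' *+ (m v).+1 else 0)); last first.
  move=> k _; rewrite mcoeffU; have [kv|kv] := eqVneq (k v) 0%N.
    by rewrite kv mulr0n mul0rn; case: eqP => // ek; move: kv; rewrite ek m'v.
  by rewrite hm //; case: eqP => [->|//]; rewrite m'v mulr1n.
rewrite -big_mkcond /=; have [mu|mu] := boolP (m' \in msupp u).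
  by rewrite (big_rem m' mu) /= eqxx big_seq_cond big1 ?addr0 // => k
     /andP[kr /eqP ek]; move: kr; rewrite ek mem_rem_uniqF ?fset_uniq.
rewrite (mcoeff_outdom mu) mul0rn big_seq_cond big1 // => k /andP[ku /eqP ek].
Qed.

Lemma dbound_pderiv u (j : 'I_n) (r : nat) :
  pderiv (j, r) u != 0 -> (r < dbound u)%N.
Proof.
rewrite -msupp_eq0 => /fset0Pn[m].
rewrite -mcoeff_neq0 mcoeff_pderiv => h.
set m' := mulcm _ _ in h.
have m'u : m' \in msupp u.
  by rewrite -mcoeff_neq0; apply: contraNneq h => ->; rewrite mul0rn.
have m'v : (j, r) \in finsupp m'.
  by rewrite mem_finsupp mulcmE ucmE eqxx addn1.
apply: (@leq_trans (\max_(v <- finsupp m') v.2.+1)).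
  exact: (@leq_bigmax_seq _ (enum_fset (finsupp m')) xpredT (fun v : dvar n => v.2.+1)
    (j, r) m'v isT).
exact: (@leq_bigmax_seq _ (enum_fset (msupp u)) xpredT
  (fun m : {cmonom dvar n} => \max_(v <- finsupp m) v.2.+1) m' m'u isT).
Qed.

Section Derivation.
Variable delta : K -> K.
Hypothesis hdelta : is_derivation delta.

Lemma derivation0 : delta 0 = 0.
Proof.
by have := hdelta.1 0 0; rewrite addr0 => /(congr1 (+%R^~ (- delta 0)));
  rewrite subrr addrK.
Qed.

Lemma derivation1 : delta 1 = 0.
Proof.
have := hdelta.2 1 1; rewrite !mulr1 mul1r => /(congr1 (+%R^~ (- delta 1))).
by rewrite subrr addrK.
Qed.

Let term m (c : K) : dpoly K n :=
  << delta c *g m >> +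
  \sum_(v <- finsupp m)
     << c *+ m v *g mulcm (divcm m (ucm v)) (ucm (vnext v)) >>.

Let term0 m : term m 0 = 0.
Proof.
rewrite /term derivation0 monalgU0 add0r big1 // => v _.
by rewrite mul0rn monalgU0.
Qed.

Let termD m : {morph term m : a b / a + b}.
Proof.
move=> a b; rewrite /term hdelta.1 monalgUD addrACA; congr (_ + _).
by rewrite -big_split /=; apply: eq_bigr => v _; rewrite mulrnDl monalgUD.
Qed.

Let termEw m c (E : {fset dvar n}) : (finsupp m `<=` E)%fset ->
  term m c = << delta c *g m >> +
    \sum_(v <- E) << c *+ m v *g mulcm (divcm m (ucm v)) (ucm (vnext v)) >>.
Proof.
move=> le; congr (_ + _); apply: big_fset_incl le _ => v _.
by rewrite -cmE_eq0 => /eqP ->; rewrite mulr0n monalgU0.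
Qed.

Let ddiffEw u (E : {fset {cmonom dvar n}}) : (msupp u `<=` E)%fset ->
  ddiff delta u = \sum_(m <- E) term m u@_m.
Proof.
move=> le; apply: big_fset_incl le _ => m _ /mcoeff_outdom ->; exact: term0.
Qed.

Let ddiffU c m : ddiff delta << c *g m >> = term m c.
Proof. by rewrite (ddiffEw msuppU_le) big_seq_fset1 mcoeffUU. Qed.

Let ddiffD : {morph ddiff delta : u w / u + w}.
Proof.
move=> u w; rewrite (ddiffEw (msuppD_le u w)).
rewrite (ddiffEw (fsubsetUl (msupp u) (msupp w))).
rewrite (ddiffEw (fsubsetUr (msupp u) (msupp w))).
by rewrite -big_split; apply: eq_bigr => m _; rewrite mcoeffD termD.
Qed.

Let ddiff0 : ddiff delta 0 = 0.
Proof. by rewrite /ddiff msupp0 big_seq_fset0. Qed.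

Let malgUM (a b : K) (m1 m2 : {cmonom dvar n}) :
  << a *g m1 >> * << b *g m2 >> = << a * b *g mulcm m1 m2 >> :> dpoly K n.
Proof. exact: fgmulUU. Qed.

Let divcmM m1 m2 v : m1 v != 0%N ->
  divcm (mulcm m1 m2) (ucm v) = mulcm (divcm m1 (ucm v)) m2.
Proof.
move=> m1v; apply/eqP/cmP => i; rewrite divcmE !mulcmE divcmE ucmE.
case: eqP => [<-|_] /=; last by rewrite !subn0.
by rewrite addnBAC // lt0n.
Qed.

Let termM a b m1 m2 : term (mulcm m1 m2) (a * b) =
  term m1 a * << b *g m2 >> + << a *g m1 >> * term m2 b.
Proof.
set E := (finsupp m1 `|` finsupp m2)%fset.
rewrite (@termEw (mulcm m1 m2) _ E); last by rewrite mdomD fsubset_refl.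
rewrite (@termEw m1 _ E) ?fsubsetUl //.
rewrite (@termEw m2 _ E) ?fsubsetUr //.
have distr (p q r w x y : dpoly K n) :
    (p + q) * y + x * (r + w) = (p * y + x * r) + (q * y + x * w).
  by rewrite mulrDl mulrDr [LHS]addrACA.
apply: esym; apply: etrans (distr _ _ _ _ _ _) _; congr (_ + _).
  apply: etrans (congr2 +%R (malgUM _ _ _ _) (malgUM _ _ _ _)) _.
  by rewrite -monalgUD -hdelta.2.
apply: etrans (congr2 +%R (mulr_suml _ _ _ _) (mulr_sumr _ _ _ _)) _.
apply: etrans (esym (big_split _ _ _ _ _)) _; apply: eq_bigr => v _.
apply: etrans (congr2 +%R (malgUM _ _ _ _) (malgUM _ _ _ _)) _.
rewrite mulcmE (mulrnDr (a * b)) monalgUD (mulrnAl a) (mulrnAr a).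
apply: esym; apply: (congr2 +%R).
  have [->|m1v] := eqVneq (m1 v) 0%N; first by rewrite mulr0n !monalgU0.
  apply: (congr1 (fun k => << a * b *+ m1 v *g k >>)).
  by rewrite (divcmM _ m1v) -[LHS]mulcmA -[RHS]mulcmA [mulcm m2 _]mulcmC.
have [->|m2v] := eqVneq (m2 v) 0%N; first by rewrite mulr0n !monalgU0.
apply: (congr1 (fun k => << a * b *+ m2 v *g k >>)).
by rewrite [mulcm m1 m2]mulcmC (divcmM _ m2v) [mulcm _ m1]mulcmC -[LHS]mulcmA.
Qed.

Let ddiffUM a b m1 m2 :
  ddiff delta (<< a *g m1 >> * << b *g m2 >>) =
  ddiff delta << a *g m1 >> * << b *g m2 >> +
  << a *g m1 >> * ddiff delta << b *g m2 >>.
Proof.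
apply: etrans (congr1 (ddiff delta) (malgUM a b m1 m2)) _.
apply: etrans (ddiffU _ _) _; apply: etrans (termM _ _ _ _) _.
exact: (congr2 +%R (congr2 *%R (esym (ddiffU a m1)) erefl)
                   (congr2 *%R erefl (esym (ddiffU b m2)))).
Qed.

Lemma ddiff_derivation : is_derivation (ddiff delta).
Proof.
split=> [|u w]; first exact: ddiffD.
rewrite [u]monalgE [w]monalgE.
apply: leibniz_sum => [||m1 m2]; [exact: ddiff0 | exact: ddiffD | exact: ddiffUM].
Qed.

Lemma ddiffC (c : K) : ddiff delta c%:MP = (delta c)%:MP.
Proof. by rewrite ddiffU /term mdom1 big_seq_fset0 addr0. Qed.

Lemma ddiffX v : ddiff delta (dX v) = dX (vnext v).
Proof.
rewrite ddiffU /term derivation1 monalgU0 add0r mdomU big_seq_fset1 cmUU.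
rewrite mulr1n; apply: (congr1 (fun k => << 1 *g k >>)).
by apply/eqP/cmP => i; rewrite mulcmE divcmE subnn.
Qed.

End Derivation.

End DiffPoly.

(** * Jacobi bound *)

Variant convention := Strong | Weak.

Definition ord_none (c : convention) : \bar int :=
  match c with Strong => -oo%E | Weak => 0%E end.

(* By [dbound_pderiv], the restriction r < dbound u loses nothing. *)
Definition dord (K : fieldType) (n : nat) (c : convention) (j : 'I_n)
    (u : dpoly K n) : \bar int :=
  \big[maxe/ord_none c]_(r < dbound u | pderiv (j, val r) u != 0)
    (Posz r)%:E%E.

Definition jacobi_bound (K : fieldType) (n : nat) (c : convention)
    (u : 'I_n -> dpoly K n) : \bar int :=
  \big[maxe/-oo%E]_(rho : 'S_n) (\sum_(i < n) dord c (rho i) (u i))%E.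

(** * Differential ideals and minimal primes *)

Definition is_diff_ideal (K : fieldType) (n : nat) (delta : K -> K)
    (I : dpoly K n -> Prop) : Prop :=
  [/\ I 0,
      forall p q, I p -> I q -> I (p + q),
      forall p q, I q -> I (p * q) &
      forall p, I p -> I (ddiff delta p)].

Definition diff_ideal_gen (K : fieldType) (n : nat) (delta : K -> K)
    (u : 'I_n -> dpoly K n) (p : dpoly K n) : Prop :=
  forall I, is_diff_ideal delta I -> (forall i, I (u i)) -> I p.

Definition is_minimal_prime_over (R : comNzRingType) (I : R -> Prop)
    (P : prime_idealr R) : Prop :=
  (forall p, I p -> p \in P) /\
  (forall Q : prime_idealr R,
     (forall p, I p -> p \in Q) -> {subset Q <= P} -> {subset P <= Q}).

(** * Residue fields *)

Section ResidueField.
Variables (R : comNzRingType) (P : prime_idealr R).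

Definition quot_dom : Type := {ideal_quot P}.
HB.instance Definition _ := GRing.ComNzRing.on quot_dom.

(* {ideal_quot P} has no inverse operation in the library, and {fraction _}
   requires one: take the classical one. *)
Definition quot_unit : pred quot_dom := fun x => `[< exists y, y * x = 1 >].

Definition quot_inv (x : quot_dom) : quot_dom :=
  if pselect (exists y, y * x = 1) is left e then projT1 (cid e) else x.

Fact quot_mulVx : {in quot_unit, left_inverse 1 quot_inv *%R}.
Proof.
move=> x /asboolP ux; rewrite /quot_inv.
by case: pselect => // e; case: (cid e).
Qed.

Fact quot_unitPl (x y : quot_dom) : y * x = 1 -> quot_unit x.
Proof. by move=> yx; apply/asboolP; exists y. Qed.

Fact quot_invx_out : {in [predC quot_unit], quot_inv =1 id}.
Proof.
move=> x /asboolPn nux; rewrite /quot_inv.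
by case: pselect.
Qed.

HB.instance Definition _ := GRing.ComNzRing_hasMulInverse.Build quot_dom
  quot_mulVx quot_unitPl quot_invx_out.

HB.instance Definition _ := GRing.ComUnitRing_isIntegral.Build quot_dom
  (@Quotient.rquot_IdomainAxiom R P).

Definition quot_proj (x : R) : quot_dom := \pi_({ideal_quot P})%qT x.
HB.instance Definition _ :=
  GRing.RMorphism.copy quot_proj (\pi_({ideal_quot P})%qT : R -> {ideal_quot P}).

(* kappa(P) = Frac(R / P) *)
Definition residue_field : fieldType := {fraction quot_dom}.

Definition residue_map : R -> residue_field :=
  @FracField.tofrac quot_dom \o quot_proj.
HB.instance Definition _ := GRing.RMorphism.on residue_map.

End ResidueField.

Definition base_map (K : fieldType) (n : nat) (P : prime_idealr (dpoly K n)) :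
  {rmorphism K -> residue_field P} := residue_map P \o malgC.

(** * Transcendence degree *)

Section TrDeg.
Variables (F L : fieldType) (iota : {rmorphism F -> L}).

Definition alg_independent (d : nat) (t : 'I_d -> L) : Prop :=
  forall p : {mpoly F[d]},
    mmap iota (fun m : 'X_{1..d} => \prod_(i < d) t i ^+ m i) p = 0 -> p = 0.

(* The transcendence degree of L over F is finite and equal to d: the largest
   cardinality of an algebraically independent family is d. *)
Definition has_trdeg (d : nat) : Prop :=
  (exists t : 'I_d -> L, alg_independent t) /\
  (forall e (t : 'I_e -> L), alg_independent t -> (e <= d)%N).

End TrDeg.

(* Main.v *)
Require Import Defs.
From HB Require Import structures.
From mathcomp Require Import all_boot all_order all_algebra all_fingroup.
From mathcomp Require Import finmap.
From mathcomp.multinomials Require Import monalg.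
From mathcomp Require Import boolp constructive_ereal.
From mathcomp Require classical_sets.
From mathcomp Require Import zify.

Set Implicit Arguments.
Unset Strict Implicit.
Unset Printing Implicit Defensive.

Import Order.TTheory GRing.Theory Num.Theory.

Local Open Scope ring_scope.

(** Up to constants, the equation u_i = 0 is the i-th row of a matrix A of
    linear differential operators, with entries in the skew polynomial ring
    K[D], and each derivative of u_i is an affine relation over K between the
    coordinates x_j^(r) of the generic point of the component.

    Upper bound. By duality for the assignment problem ([assignment_duality])
    there are integers a_i, b_j with ord A_ij <= a_i + b_j for all i, j and with
    equality along an optimal permutation rho. For N large, the derivatives of
    u_i of order < N - a_i only involve the x_j^(r) with r < N + b_j. If these
    relations are linearly independent, then they leave
      sum_j (N + b_j) - sum_i (N - a_i) = sum_i ord A_(i, rho i)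
    free parameters, of which all the x_j^(r) concerned are affine functions,
    and this number bounds the transcendence degree ([transcendence_bound]).
    A zero entry of A receives a very negative weight: as the bound obtained is
    at least the transcendence degree, hence nonnegative, rho avoids such
    entries ([assignment_bound]). The bound is then a sum of orders of variables
    that do occur, which is at most the Jacobi number in either convention.

    Independence of the relations. It means that the rows of A are left
    independent over K[D]. By a count of dimensions ([op_rows_free]; this is the
    Ore property of K[D]), it is enough that for each j the row module contains
    a nonzero operator in x_j alone ([component_torsion]).

    Existence of that operator. This is where the finiteness of the
    transcendence degree d and the minimality of P enter. If there is none for
    some j, then the x_j^(r) are independent modulo the rows, so some K-linear
    functionals on linear forms kill the rows and take prescribed values at
    x_j, ..., x_j^(d) ([separating_functional]). Such a functional is a solution
    of the homogeneous system, and translating the generic point by it gives a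
    ring morphism whose kernel is a prime ideal between [u] and P; by minimality
    it contains P, so the component is invariant under the translation
    ([translate_component]). On the other hand d + 1 elements of the residue
    field satisfy a nontrivial polynomial relation, and no such relation between
    x_j, ..., x_j^(d) survives all translations ([kronecker_neq0]). *)

(** * Linear differential operators *)
Section Operators.
Variables (K : fieldType) (delta : K -> K).
Hypothesis hdelta : is_derivation delta.
Let delta0 := derivation0 hdelta.
Let deltaD := hdelta.1.
Let deltaM := hdelta.2.
Implicit Types p q r : {poly K}.

(** A polynomial stands for the operator sum_r q`_r D^r; [opD] is composition
    with D on the left, so the rule D c = c D + delta c is built in, and [opmul]
    is the product of the skew polynomial ring. *)
Definition opD q : {poly K} := 'X * q + map_poly delta q.

Definition opmul p q : {poly K} := \sum_(k < size p) p`_k *: iter k opD q.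

Lemma coef_opD q i : (opD q)`_i = (if i is i'.+1 then q`_i' else 0) + delta q`_i.
Proof. by rewrite coefD coefXM coef_map_id0 //; case: i. Qed.

Lemma opD_add p q : opD (p + q) = opD p + opD q.
Proof.
apply/polyP => i; rewrite coefD !coef_opD !coefD deltaD.
by case: i => [|i]; rewrite ?add0r ?coefD // addrACA.
Qed.

Lemma opDZ c q : opD (c *: q) = c *: opD q + delta c *: q.
Proof.
apply/polyP => i; rewrite coef_opD coefD !coefZ coef_opD deltaM mulrDr.
rewrite -[RHS]addrA [c * _ + delta c * _]addrC; congr (_ + _).
by case: i => [|i]; rewrite ?coefZ ?mulr0.
Qed.

Lemma opD0 : opD 0 = 0.
Proof. by rewrite /opD mulr0 map_poly0 addr0. Qed.

Lemma iter_opD_add k p q : iter k opD (p + q) = iter k opD p + iter k opD q.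
Proof. by elim: k => //= k ->; rewrite opD_add. Qed.

Lemma iter_opD0 k : iter k opD 0 = 0.
Proof. by elim: k => //= k ->; rewrite opD0. Qed.

Lemma size_opD q s : (size q <= s)%N -> (size (opD q) <= s.+1)%N.
Proof.
move=> h; apply/leq_sizeP => i hi; rewrite coef_opD.
case: i hi => // i hi; rewrite (leq_sizeP _ _ h) ?(leq_trans h) //.
by rewrite (leq_sizeP _ _ h) ?delta0 ?addr0 // ltnW.
Qed.

Lemma size_iter_opD k q s : (size q <= s)%N -> (size (iter k opD q) <= k + s)%N.
Proof. by move=> h; elim: k => //= k; rewrite addSn; exact: size_opD. Qed.

Lemma coef_iter_opD k q s : (size q <= s.+1)%N -> (iter k opD q)`_(k + s) = q`_s.
Proof.
move=> h; elim: k => //= k IH; rewrite addSn coef_opD IH.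
rewrite [X in delta X](leq_sizeP _ _ (size_iter_opD k h)) ?addnS //.
by rewrite delta0 addr0.
Qed.

Lemma opmulEw N p q : (size p <= N)%N -> opmul p q = \sum_(k < N) p`_k *: iter k opD q.
Proof.
move=> h; rewrite /opmul (big_ord_widen N (fun k => p`_k *: iter k opD q)) //.
rewrite big_mkcond; apply: eq_bigr => k _; case: ltnP => // hk.
by rewrite nth_default // scale0r.
Qed.

Lemma opmulDl p q r : opmul (p + q) r = opmul p r + opmul q r.
Proof.
set N := maxn (size p) (size q).
rewrite (@opmulEw N (p + q)) ?size_polyD // (@opmulEw N p) ?leq_maxl //.
rewrite (@opmulEw N q) ?leq_maxr // -big_split; apply: eq_bigr => k _.
by rewrite coefD scalerDl.
Qed.

Lemma opmul0l q : opmul 0 q = 0.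
Proof. by rewrite /opmul size_poly0 big_ord0. Qed.

Lemma opmul0r p : opmul p 0 = 0.
Proof. by rewrite /opmul big1 // => k _; rewrite iter_opD0 scaler0. Qed.

Lemma opmulZl c p q : opmul (c *: p) q = c *: opmul p q.
Proof.
rewrite (@opmulEw (size p) (c *: p)) ?size_scale_leq // /opmul scaler_sumr.
by apply: eq_bigr => k _; rewrite coefZ scalerA.
Qed.

Lemma opmulDr p q r : opmul p (q + r) = opmul p q + opmul p r.
Proof.
rewrite /opmul -big_split; apply: eq_bigr => k _.
by rewrite iter_opD_add scalerDr.
Qed.

Lemma opD_opmul p q : opD (opmul p q) = opmul (opD p) q.
Proof.
rewrite (@opmulEw (size p).+1 (opD p)) ?size_opD // /opmul.
rewrite (big_morph opD opD_add opD0).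
rewrite (eq_bigr (fun k : 'I_(size p) =>
  p`_k *: iter k.+1 opD q + delta p`_k *: iter k opD q)); last first.
  by move=> k _; rewrite opDZ.
rewrite big_split /= [RHS](eq_bigr (fun k : 'I_(size p).+1 =>
  (if k : nat is k'.+1 then p`_k' else 0) *: iter k opD q
  + delta p`_k *: iter k opD q)); last first.
  by move=> k _; rewrite coef_opD scalerDl.
rewrite [RHS]big_split /=; congr (_ + _).
  by rewrite big_ord_recl scale0r add0r.
by rewrite big_ord_recr /= nth_default // delta0 scale0r addr0.
Qed.

Lemma iter_opD_opmul k p q : iter k opD (opmul p q) = opmul (iter k opD p) q.
Proof. by elim: k => //= k ->; rewrite opD_opmul. Qed.

Lemma opmul_suml (I : Type) (s : seq I) (P : pred I) (F : I -> {poly K}) q :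
  opmul (\sum_(i <- s | P i) F i) q = \sum_(i <- s | P i) opmul (F i) q.
Proof. by apply: (big_morph (opmul^~ q)) => [x y|]; rewrite ?opmulDl ?opmul0l. Qed.

Lemma opmul_sumr (I : Type) (s : seq I) (P : pred I) (F : I -> {poly K}) p :
  opmul p (\sum_(i <- s | P i) F i) = \sum_(i <- s | P i) opmul p (F i).
Proof. by apply: (big_morph (opmul p)) => [x y|]; rewrite ?opmulDr ?opmul0r. Qed.

Lemma opmulA p q r : opmul p (opmul q r) = opmul (opmul p q) r.
Proof.
rewrite (opmulEw (opmul q r) (leqnn (size p))) (opmulEw q (leqnn (size p))).
rewrite opmul_suml; apply: eq_bigr => k _.
by rewrite opmulZl iter_opD_opmul.
Qed.

(** The product has the expected leading coefficient, since D does not change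
    leading coefficients; hence no zero divisors. *)
Lemma opmul_eq0 p q : opmul p q = 0 -> p != 0 -> q = 0.
Proof.
move=> h p0; apply/eqP; apply: contraT => q0.
have [s ps] : exists s, size p = s.+1.
  by exists (size p).-1; rewrite prednK // lt0n size_poly_eq0.
have [t qt] : exists t, size q = t.+1.
  by exists (size q).-1; rewrite prednK // lt0n size_poly_eq0.
have /eqP := congr1 (fun x : {poly K} => x`_(s + t)) h.
rewrite coef0 /opmul ps big_ord_recr /= coefD coefZ coef_iter_opD ?qt //.
rewrite coef_sum big1 ?add0r => [|k _]; last first.
  rewrite coefZ [X in _ * X]nth_default ?mulr0 //.
  by rewrite (leq_trans (size_iter_opD k (leqnn _))) // qt addnS -addSn leq_add2r.
have -> : p`_s = lead_coef p by rewrite /lead_coef ps.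
have -> : q`_t = lead_coef q by rewrite /lead_coef qt.
by rewrite mulf_eq0 !lead_coef_eq0 (negPf p0) (negPf q0).
Qed.
Lemma opmulXn k (a : {poly K}) : opmul 'X^k a = iter k opD a.
Proof.
rewrite /opmul size_polyXn (bigD1 ord_max) //= coefXn eqxx scale1r.
rewrite big1 ?addr0 // => i ik.
rewrite coefXn; case: eqP => [e|]; rewrite ?scale0r //.
by case/eqP: ik; apply: val_inj.
Qed.
End Operators.

(** * Independence of the rows of an operator matrix *)
Section CoefMatrix.
Variables (K : fieldType) (n : nat) (I : finType).
Variables (F : I -> 'I_n -> {poly K}) (l : 'I_n -> nat).

Definition coefmx : 'M[K]_(#|I|, #|{: {j : 'I_n & 'I_(l j)}}|) :=
  \matrix_(a < #|I|, b < #|{: {j : 'I_n & 'I_(l j)}}|)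
    (F (enum_val a) (tag (enum_val b)))`_(nat_of_ord (tagged (enum_val b))).

(** Turns independence of vectors of polynomials into a statement on ranks: the
    size bounds ensure that the matrix sees all coefficients. *)
Lemma row_free_coefmx :
  (forall i j, (size (F i j) <= l j)%N) ->
  (forall x : I -> K, (forall j, \sum_i x i *: F i j = 0) -> forall i, x i = 0) ->
  row_free coefmx.
Proof.
move=> szF indep; rewrite -kermx_eq0; apply/rowV0P => v /sub_kermxP vM.
apply/rowP => a; rewrite mxE -[a]enum_valK.
apply: (indep (fun i => v 0 (enum_rank i))) => j; apply/polyP => r.
rewrite coef0 coef_sum; have [hr|hr] := ltnP r (l j); last first.
  by rewrite big1 // => i _; rewrite coefZ nth_default ?mulr0 // (leq_trans (szF _ _)).
have /rowP/(_ (enum_rank (Tagged (fun j => 'I_(l j)) (Ordinal hr)))) := vM.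
rewrite !mxE; apply: etrans; rewrite (reindex_onto (@enum_val I I) (@enum_rank I)) /=.
  apply: eq_big => [b|b _]; first by rewrite enum_valK eqxx.
  by rewrite coefZ enum_valK mxE enum_rankK.
by move=> i _; rewrite enum_rankK.
Qed.

Lemma card_tagged_ord : #|{: {j : 'I_n & 'I_(l j)}}| = (\sum_j l j)%N.
Proof.
rewrite card_tagged sumnE big_map big_enum; apply: eq_bigr => j _.
by rewrite card_ord.
Qed.

End CoefMatrix.

Section OperatorMatrix.
Variables (K : fieldType) (delta : K -> K).
Hypothesis hdelta : is_derivation delta.
Variables (n : nat) (A : 'I_n -> 'I_n -> {poly K}).

(** If Q A is diagonal with nonzero entries and p A = 0, then v |-> v Q embeds
    K[D]^n in a subspace that meets the left kernel of A trivially, while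
    c |-> c p maps K[D] into that kernel. If p
    were nonzero this would put n + 1 copies of K[D] in K[D]^n with a bounded
    increase s of the degrees, and (n + 1) N <= n (N + s) fails for large N. *)
Lemma op_rows_free (p : 'I_n -> {poly K}) :
  (forall j, exists2 q : 'I_n -> {poly K},
    \sum_i opmul delta (q i) (A i j) != 0 &
    forall j', j' != j -> \sum_i opmul delta (q i) (A i j') = 0) ->
  (forall j, \sum_i opmul delta (p i) (A i j) = 0) -> forall i, p i = 0.
Proof.
move=> tors pA i0; apply/eqP; apply: contraT => p0.
have /fin_all_exists[q qP] : forall j, exists q : 'I_n -> {poly K},
    \sum_i opmul delta (q i) (A i j) != 0 /\
    forall j', j' != j -> \sum_i opmul delta (q i) (A i j') = 0.
  by move=> j; have [q ? ?] := tors j; exists q.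
(* None carries the hypothetical relation p, Some j the j-th row of Q. *)
pose G (o : option 'I_n) := if o is Some j then q j else p.
pose s := (\max_(o : option 'I_n) \max_i size (G o i))%N.
have szG o i : (size (G o i) <= s)%N.
  apply: (@leq_trans (\max_i size (G o i))%N).
    exact: (leq_bigmax (F := fun i => size (G o i)) i).
  exact: (leq_bigmax (F := fun o => \max_i size (G o i))%N o).
(* The first N with (n + 1) N > n (N + s). *)
pose N := (n * s).+1.
pose F (x : option 'I_n * 'I_N) i := iter x.2 (opD delta) (G x.1 i).
have szF x i : (size (F x i) <= N + s)%N.
  by apply: leq_trans (size_iter_opD hdelta x.2 (szG x.1 i)) _; rewrite leq_add2r ltnW.
have /eqP : row_free (coefmx F (fun=> (N + s)%N)).
  apply: row_free_coefmx => // x xF.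
  pose P o := \poly_(k < N) x (o, inord k).
  have PG i : \sum_o opmul delta (P o) (G o i) = 0.
    apply: etrans (xF i).
    rewrite (eq_bigr (fun o => \sum_(k < N) x (o, k) *: F (o, k) i)); last first.
      move=> o _; rewrite (opmulEw _ _ (size_poly _ _)); apply: eq_bigr => k _.
      by rewrite coef_poly ltn_ord inord_val.
    by rewrite pair_big; apply: eq_bigr => -[].
  (* Multiplying by A kills the summand of p and leaves P (Some j) T_j. *)
  have PS j : P (Some j) = 0.
    apply/eqP; apply: contraT => Pj; case: (qP j) => /negP[]; apply/eqP.
    apply: (opmul_eq0 hdelta _ Pj).
    transitivity (\sum_i opmul delta (\sum_o opmul delta (P o) (G o i)) (A i j));
      last first.
      by rewrite big1 // => i _; rewrite PG opmul0l.
    apply: esym; rewrite (eq_bigr (fun i =>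
      \sum_o opmul delta (P o) (opmul delta (G o i) (A i j)))); last first.
      by move=> i _; rewrite opmul_suml //; apply: eq_bigr => o _; rewrite opmulA.
    rewrite exchange_big /= (bigD1 (Some j)) //= -opmul_sumr //.
    rewrite [X in _ + X]big1 ?addr0 // => -[j'|] /= hj; rewrite -opmul_sumr //.
      by rewrite (proj2 (qP j')) ?opmul0r //; apply: contra_neq hj => ->.
    by rewrite pA opmul0r.
  have PN : P None = 0.
    apply/eqP; apply: contraT => PN; case/negP: p0; apply/eqP.
    apply: (opmul_eq0 hdelta _ PN); have := PG i0.
    rewrite (bigD1 None) //= big1 ?addr0 // => -[j|] // _; by rewrite PS opmul0l.
  move=> [o k]; have : (P o)`_k = 0 by case: (o) => [j|]; rewrite ?PS ?PN coef0.
  by rewrite coef_poly ltn_ord inord_val.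
move=> rk; have := rank_leq_col (coefmx F (fun=> (N + s)%N)).
rewrite rk card_prod card_option !card_ord card_tagged_ord sum_nat_const card_ord.
by rewrite mulnDr mulSn addnC leq_add2l ltnn.
Qed.
End OperatorMatrix.

(** * Duality for the assignment problem *)
Section Paths.
Variables (I : finType) (R : realDomainType) (c : I -> I -> R).

Fixpoint path_weight x s := if s is y :: s' then c x y + path_weight y s' else 0.

Lemma path_weight_cat x s1 s2 :
  path_weight x (s1 ++ s2) = path_weight x s1 + path_weight (last x s1) s2.
Proof. by elim: s1 x => [|y s IH] x /=; rewrite ?add0r // IH addrA. Qed.

Lemma path_weightE x0 x s :
  path_weight x s = \sum_(k < size s) c (nth x0 (x :: s) k) (nth x0 s k).
Proof.
by elim: s x => [|y s IH] x; rewrite ?big_ord0 // big_ord_recl /= IH.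
Qed.

Lemma path_weight_cycle x s : uniq (x :: s) ->
  path_weight x (rcons s x) = \sum_(y <- x :: s) c y (next (x :: s) y).
Proof.
move=> us; rewrite (path_weightE x) size_rcons (big_nth x) big_mkord.
apply: eq_bigr => k _; rewrite next_nth mem_nth // index_uniq // nth_rcons.
rewrite -rcons_cons nth_rcons ltn_ord; congr (c _ _).
by case: ltngtP => // h; rewrite nth_default ?h // ltnW.
Qed.

Hypothesis cycle_le0 : forall x s, uniq (x :: s) -> path_weight x (rcons s x) <= 0.

(** The potential of x is the largest weight of a simple path from x. When the
    optimal path from y already visits x, the arc x -> y closes a cycle, which
    can be dropped without loss because its weight is at most 0. *)
Lemma potential_exists : exists a : I -> R, forall x y, c x y + a y <= a x.
Proof.
pose m x := [arg max_(s > [bseq] : #|I|.-bseq I | uniq (x :: s)) path_weight x s]%O.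
have mP x : uniq (x :: m x) /\
    forall s, uniq (x :: s) -> path_weight x s <= path_weight x (m x).
  rewrite /m; case: Order.TotalTheory.arg_maxP => //= s us smax; split=> // t ut.
  have szt : (size t <= #|I|)%N.
    by have /andP[_ /card_uniqP <-] := ut; exact: max_card.
  exact: (smax (Bseq szt)).
exists (fun x => path_weight x (m x)) => x y.
have [uy _] := mP y; have [_ xmax] := mP x.
have [xy|xy] := boolP (x \in y :: m y); last first.
  have -> : c x y + path_weight y (m y) = path_weight x (y :: m y) by [].
  by apply: xmax; rewrite cons_uniq xy.
have [xey|xny] := eqVneq x y.
  rewrite -xey; have := @cycle_le0 x [::] isT => /=; rewrite addr0 => h.
  by rewrite gerDr.
have {xy} xm : x \in m y by move: xy; rewrite inE (negPf xny).
case/splitPr: xm uy => s1 s2 uy.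
have -> : c x y + path_weight y (s1 ++ x :: s2)
   = path_weight x (rcons (y :: s1) x) + path_weight x s2.
  by rewrite /= -cats1 !path_weight_cat /= addr0 !addrA.
apply: le_trans (_ : path_weight x s2 <= _).
  rewrite gerDr; apply: cycle_le0; move: uy.
  by rewrite -cat_cons uniq_catC cat_cons cons_uniq mem_cat negb_or cat_uniq
     => /and3P[/andP[_ h] _ /andP[_ us]]; apply/andP.
by apply: xmax; move: uy; rewrite -cat_cons cat_uniq => /and3P[].
Qed.
End Paths.

(** For an optimal rho, let the arc i -> j have weight w i (rho j) - w j (rho j).
    A cycle of positive weight would improve rho when composed with it, so
    potentials exist, and they are the dual variables a; b is then forced by
    equality along rho. *)
Lemma assignment_duality (I : finType) (R : realDomainType) (w : I -> I -> R) :
  exists (rho : {perm I}) (a b : I -> R),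
    (forall i j, w i j <= a i + b j) /\ (forall i, w i (rho i) = a i + b (rho i)).
Proof.
case: (@Order.TotalTheory.arg_maxP _ _ _ (1%g : {perm I}) xpredT
         (fun s : {perm I} => \sum_i w i (s i))) => // rho _ rhomax.
pose c i j := w i (rho j) - w j (rho j).
have cycle_le0 x s : uniq (x :: s) -> path_weight c x (rcons s x) <= 0.
  move=> us; rewrite path_weight_cycle //.
  pose sigma := perm (can_inj (prev_next us)).
  have := rhomax (sigma * rho)%g isT.
  have -> : \sum_i w i (rho i) = \sum_i w (sigma i) (rho (sigma i)).
    exact: (reindex_inj (@perm_inj _ sigma)).
  rewrite /= -subr_le0 -sumrB.
  rewrite (bigID (mem (x :: s))) /= [X in _ + X]big1 => [|i ni]; last first.
    by rewrite permM permE next_nth (negPf ni) subrr.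
  rewrite addr0 -big_uniq //; apply: le_trans; rewrite le_eqVlt; apply/orP; left.
  by apply/eqP; apply: eq_bigr => i _; rewrite permM permE.
have [a aP] := potential_exists cycle_le0.
exists rho, a, (fun j => w ((rho^-1)%g j) j - a ((rho^-1)%g j)); split=> [i j|i].
  have := aP i ((rho^-1)%g j); rewrite /c permKV => h.
  by rewrite addrCA -lerBlDl lerBrDr.
by rewrite permK addrC subrK.
Qed.

(** * Bounding transcendence degrees *)
Lemma linear_dependence (K : fieldType) (I J : finType) (M : I -> J -> K) :
  (#|J| < #|I|)%N -> exists2 x : I -> K, (exists i, x i != 0) &
    forall j, \sum_i x i * M i j = 0.
Proof.
move=> ltJI; pose A := \matrix_(a < #|I|, b < #|J|) M (enum_val a) (enum_val b).
have : kermx A != 0.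
  by rewrite kermx_eq0 -row_leq_rank -ltnNge (leq_ltn_trans (rank_leq_col _)).
case/rowV0Pn => v /sub_kermxP vA v0; exists (fun i => v 0 (enum_rank i)).
  by have /rV0Pn[a va] := v0; exists (enum_val a); rewrite enum_valK.
move=> j; have /rowP/(_ (enum_rank j)) := vA; rewrite !mxE => h; apply: etrans h.
rewrite (reindex_onto (@enum_val I I) (@enum_rank I)) /=; last first.
  by move=> i _; rewrite enum_rankK.
apply: eq_big => [b|b _]; first by rewrite enum_valK eqxx.
by rewrite enum_valK !mxE enum_rankK.
Qed.

Section BoundedSpan.
Variables (K L : fieldType) (iota : {rmorphism K -> L}) (D : nat) (z : 'I_D -> L).

(** The degree bound is kept separately in each coordinate of z, so that for each
    B the values form a space spanned by (B + 1)^D elements. *)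
Definition poly_value B (x : L) := exists c : {ffun 'I_D -> 'I_B.+1} -> K,
  x = \sum_b iota (c b) * \prod_i z i ^+ b i.

Lemma poly_value0 B : poly_value B 0.
Proof. by exists (fun=> 0); rewrite big1 // => b _; rewrite rmorph0 mul0r. Qed.

Lemma poly_valueD B x y : poly_value B x -> poly_value B y -> poly_value B (x + y).
Proof.
move=> [c ->] [c' ->]; exists (fun b => c b + c' b); rewrite -big_split.
by apply: eq_bigr => b _; rewrite rmorphD mulrDl.
Qed.

Lemma poly_valueZ B k x : poly_value B x -> poly_value B (iota k * x).
Proof.
move=> [c ->]; exists (fun b => k * c b); rewrite mulr_sumr.
by apply: eq_bigr => b _; rewrite rmorphM mulrA.
Qed.

Lemma poly_value_sum B (I : Type) (s : seq I) (P : pred I) (F : I -> L) :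
  (forall i, P i -> poly_value B (F i)) -> poly_value B (\sum_(i <- s | P i) F i).
Proof.
move=> h; apply: (big_ind (poly_value B)) => //; first exact: poly_value0.
exact: poly_valueD.
Qed.

Lemma poly_value_monomial B (b : 'I_D -> nat) : (forall i, b i <= B)%N ->
  poly_value B (\prod_i z i ^+ b i).
Proof.
move=> bB; pose b' := [ffun i => inord (b i) : 'I_B.+1].
exists (fun b => (b == b')%:R); rewrite (bigD1 b') //= eqxx rmorph1 mul1r.
rewrite [X in _ + X]big1 ?addr0 => [|d /negPf->]; last by rewrite rmorph0 mul0r.
by apply: eq_bigr => i _; rewrite ffunE inordK ?ltnS.
Qed.

Lemma poly_valueC B k : poly_value B (iota k).
Proof.
have := @poly_value_monomial B (fun=> 0%N) (fun=> leq0n _).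
by move/(poly_valueZ k); rewrite big1 ?mulr1.
Qed.

Lemma poly_valueX i : poly_value 1 (z i).
Proof.
have := @poly_value_monomial 1 (fun j => (j == i) : nat) (fun j => leq_b1 _).
rewrite (bigD1 i) //= eqxx expr1 big1 ?mulr1 // => j /negPf-> //.
Qed.

Lemma poly_valueM A B x y : poly_value A x -> poly_value B y ->
  poly_value (A + B) (x * y).
Proof.
move=> [c ->] [d ->]; rewrite mulr_suml; apply: poly_value_sum => a _.
rewrite mulr_sumr; apply: poly_value_sum => b _.
rewrite mulrACA -rmorphM -big_split; apply: poly_valueZ.
rewrite (eq_bigr (fun i => z i ^+ (a i + b i)))%N; last by move=> i _; rewrite exprD.
by apply: poly_value_monomial => i; rewrite leq_add // -ltnS.
Qed.

Lemma poly_valueS A B x : (A <= B)%N -> poly_value A x -> poly_value B x.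
Proof.
move=> AB hx; rewrite -[x]mulr1 -(subnKC AB).
by apply: poly_valueM => //; rewrite -(rmorph1 iota); exact: poly_valueC.
Qed.

Lemma poly_value_exp B x k : poly_value B x -> poly_value (k * B) (x ^+ k).
Proof.
move=> hx; elim: k => [|k IH].
  by rewrite expr0 -(rmorph1 iota); exact: poly_valueC.
by rewrite exprS mulSn; exact: poly_valueM.
Qed.

Lemma poly_value_prod B e (F : 'I_e -> L) :
  (forall i, poly_value B (F i)) -> poly_value (e * B) (\prod_i F i).
Proof.
elim: e F => [|e IH] F hF.
  by rewrite big_ord0 -(rmorph1 iota); exact: poly_valueC.
by rewrite big_ord_recl mulSn; apply: poly_valueM => //; exact: IH.
Qed.

(** Counting monomials: after multiplication by a common denominator G, the
    (m + 1)^e monomials in t with exponents <= m are values of polynomials of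
    degree <= e m B in z, a space of dimension <= (e m B + 1)^D. If D < e then
    for large m the first number exceeds the second, so the monomials in t are
    linearly dependent over K. *)
Lemma alg_independent_le e (t : 'I_e -> L) :
  (forall i, exists f g, [/\ g != 0, exists B, poly_value B f,
     exists B, poly_value B g & t i * g = f]) ->
  alg_independent iota t -> (e <= D)%N.
Proof.
move=> ht indep; rewrite leqNgt; apply/negP => ltDe.
have /fin_all_exists[f /fin_all_exists[g fgP]] := ht.
have /fin_all_exists[B1 B1P] : forall i, exists B, poly_value B (f i).
  by move=> i; have [] := fgP i.
have /fin_all_exists[B2 B2P] : forall i, exists B, poly_value B (g i).
  by move=> i; have [] := fgP i.
pose B := (\sum_i (B1 i + B2 i))%N.
have leB i : (B1 i + B2 i <= B)%N by rewrite /B (bigD1 i) //= leq_addr.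
have fB i : poly_value B (f i).
  by apply: poly_valueS (B1P i); apply: leq_trans (leB i); exact: leq_addr.
have gB i : poly_value B (g i).
  by apply: poly_valueS (B2P i); apply: leq_trans (leB i); exact: leq_addl.
(* Then (e m B + 1)^D <= (m + 1)^D (e B + 1)^D = (m + 1)^D m < (m + 1)^e. *)
pose m := ((e * B).+1 ^ D)%N.
pose G := \prod_i g i ^+ m.
have tG (a : {ffun 'I_e -> 'I_m.+1}) :
    poly_value (e * (m * B)) (G * \prod_i t i ^+ a i).
  rewrite /G -big_split /=; apply: poly_value_prod => i.
  have am : (a i <= m)%N by rewrite -ltnS.
  have -> : g i ^+ m = g i ^+ (m - a i) * g i ^+ a i by rewrite -exprD subnK.
  have -> : (m * B = (m - a i) * B + a i * B)%N by rewrite -mulnDl subnK.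
  have [_ _ _ tgf] := fgP i; rewrite -mulrA -exprMn [g i * _]mulrC tgf.
  by apply: poly_valueM; exact: poly_value_exp.
have /fin_all_exists[c cP] := tG.
case: (linear_dependence c) => [|x [a xa] xc].
  rewrite !card_ffun !card_ord; apply: (@leq_trans (m.+1 ^ D.+1)); last first.
    by rewrite leq_pexp2l.
  have leq_expn x y k : (x <= y)%N -> (x ^ k <= y ^ k)%N.
    by move=> xy; elim: k => // k IH; rewrite !expnS leq_mul.
  rewrite expnSr; apply: (@leq_ltn_trans (m.+1 ^ D * m)).
    rewrite -expnMn; apply: leq_expn.
    by rewrite mulnCA mulSn addSn ltnS [(m * _.+1)%N]mulnS addnA leq_addl.
  by rewrite ltn_pmul2l ?expn_gt0.
have [mon monE] : exists mon : {ffun 'I_e -> 'I_m.+1} -> 'X_{1..e},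
    forall a i, mon a i = a i.
  exists (fun a : {ffun 'I_e -> 'I_m.+1} =>
    [cmonom (a i : nat) | i in [fset j in enum 'I_e]%fset]%M).
  by move=> a' i; rewrite cmE fsfun_fun !inE /= mem_enum.
pose p : {mpoly K[e]} := \sum_a << x a *g mon a >>.
have p0 : p = 0.
  apply: indep; rewrite raddf_sum /=.
  have G0 : G != 0.
    by apply/prodf_neq0 => i _; rewrite expf_neq0 //; have [] := fgP i.
  apply: (mulfI G0); rewrite mulr0 mulr_sumr.
  rewrite (eq_bigr (fun a => \sum_b iota (x a * c a b) * \prod_i z i ^+ b i));
    last first.
    move=> a' _; rewrite mmapU mulrCA.
    rewrite (eq_bigr (fun i => t i ^+ a' i)); last by move=> i _; rewrite monE.
    by rewrite cP mulr_sumr; apply: eq_bigr => b _; rewrite rmorphM mulrA.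
  rewrite exchange_big big1 //= => b _.
  by rewrite -mulr_suml -rmorph_sum xc rmorph0 mul0r.
have xE : p@_(mon a) = \sum_b << x b *g mon b >>@_(mon a) by exact: raddf_sum.
have cE b : << x b *g mon b >>@_(mon a) = x b *+ (mon b == mon a) by exact: mcoeffU.
have mon_inj b : mon b = mon a -> b = a.
  by move=> h; apply/ffunP => i; apply: ord_inj; rewrite -!monE h.
have sumE : \sum_b << x b *g mon b >>@_(mon a) = x a.
  rewrite (eq_bigr _ (fun b _ => cE b)) (bigD1 a isT) /= eqxx big1 ?addr0 // => b ba.
  by case: eqP => // /mon_inj h; rewrite h eqxx in ba.
case/negP: xa; apply/eqP.
by rewrite -sumE -xE p0 mcoeff0.
Qed.
End BoundedSpan.

(** Independent relations M y = b extend, by a basis C of a complement of the row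
    space of M, to an invertible system; so y is an affine function of the
    parameters z = C y. *)
Lemma affine_parametrization (K L : fieldType) (iota : {rmorphism K -> L}) p q
    (M : 'M[K]_(p, q)) (y : 'I_q -> L) : row_free M ->
  (forall i, exists b, \sum_j iota (M i j) * y j = iota b) ->
  exists D (z : 'I_D -> L), (D + p = q)%N /\
    forall j, poly_value iota z 1 (y j).
Proof.
move=> /eqP rM /fin_all_exists[b bP].
pose C := row_base (M^C)%MS.
exists (\rank (M^C)%MS), (fun k => \sum_j iota (C k j) * y j).
have rC : (\rank (M^C)%MS + p = q)%N.
  by rewrite mxrank_compl rM subnK // -rM rank_leq_col.
split=> // j.
have full : row_full (col_mx M C).
  rewrite -sub1mx -addsmxE; apply: (@submx_trans _ _ _ _ _ _ (M + M^C)%MS).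
    by rewrite sub1mx addsmx_compl_full.
  by rewrite addsmxS // eq_row_base.
have /matrixP E := mulVpmx full.
set X := pinvmx _ in E.
have -> : y j = \sum_(k < p) iota (X j (lshift _ k)) * iota (b k) +
   \sum_(k < \rank (M^C)%MS) iota (X j (rshift p k)) * \sum_i iota (C k i) * y i.
  transitivity (\sum_i iota ((X *m col_mx M C) j i) * y i).
    rewrite (bigD1 j) //= E mxE eqxx rmorph1 mul1r big1 ?addr0 // => i ij.
    by rewrite E mxE eq_sym (negPf ij) rmorph0 mul0r.
  rewrite (eq_bigr (fun i =>
     \sum_(k < p) iota (X j (lshift _ k)) * (iota (M k i) * y i) +
     \sum_(k < \rank (M^C)%MS) iota (X j (rshift p k)) * (iota (C k i) * y i))).
    rewrite big_split /=; congr (_ + _); rewrite exchange_big /=;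
      by apply: eq_bigr => k _; rewrite -mulr_sumr ?bP.
  move=> i _; rewrite mxE big_split_ord rmorphD mulrDl !rmorph_sum !mulr_suml.
  by congr (_ + _); apply: eq_bigr => k _; rewrite ?col_mxEu ?col_mxEd rmorphM mulrA.
apply: poly_valueD; apply: poly_value_sum => k _; apply: poly_valueZ.
  exact: poly_valueC.
exact: (@poly_valueX K L iota _ (fun k => \sum_j iota (C k j) * y j) k).
Qed.

(** * Separating functionals *)
Section Separation.
Variables (K : fieldType) (V : lmodType K).

Definition is_subspace (W : V -> Prop) : Prop :=
  W 0 /\ forall c x y, W x -> W y -> W (c *: x + y).

Lemma maximal_subspace (W : V -> Prop) (v : V) : is_subspace W -> ~ W v ->
  exists M : V -> Prop, [/\ is_subspace M, forall x, W x -> M x, ~ M v &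
    forall M', is_subspace M' -> (forall x, M x -> M' x) -> ~ M' v ->
      forall x, M' x -> M x].
Proof.
move=> [W0 Wlin] Wv.
(* Zorn's lemma is applied to what is added to W, as the empty chain has empty
   union. *)
pose good (A : V -> Prop) := is_subspace (fun x => W x \/ A x) /\ ~ (W v \/ A v).
have [|A [[Asub Av] Amax]] := @classical_sets.Zorn_bigcup V good.
  move=> F Fgood Ftot; split; last first.
    by case=> // -[X FX Xv]; case: (Fgood X FX) => _; apply; right.
  split=> [|c x y]; first by left.
  move=> [Wx|[X FX Xx]] [Wy|[Y FY Yy]].
  - by left; exact: Wlin.
  - have [[_ h] _] := Fgood _ FY.
    by case: (h c x y (or_introl Wx) (or_intror Yy)) => ?; [left|right; exists Y].
  - have [[_ h] _] := Fgood _ FX.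
    by case: (h c x y (or_intror Xx) (or_introl Wy)) => ?; [left|right; exists X].
  - case: (Ftot _ _ FX FY) => [XY|YX].
      have [[_ h] _] := Fgood _ FY.
      have := h c x y (or_intror (XY _ Xx)) (or_intror Yy).
      by case=> ?; [left|right; exists Y].
    have [[_ h] _] := Fgood _ FX.
    have := h c x y (or_intror Xx) (or_intror (YX _ Yy)).
    by case=> ?; [left|right; exists X].
exists (fun x => W x \/ A x).
split=> [//|x Wx|//|M' M'sub AM' M'v x M'x]; first by left.
apply: contrapT => Ax; apply: (Amax M').
  split=> [|M'A]; last by apply: Ax; right; exact: M'A.
  by move=> y Ay; apply: AM'; right.
have E : (fun x => W x \/ M' x) = M'.
  by apply/funext => y; apply/propext; split=> [[Wy|//]|]; [apply: AM'; left|right].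
by split; rewrite ?E // => -[Wv'|//].
Qed.

(** A subspace M that is maximal for avoiding v is a hyperplane complementary to
    the line of v; the functional is the coordinate along v. *)
Lemma separating_functional (W : V -> Prop) (v : V) : is_subspace W -> ~ W v ->
  exists f : V -> K, [/\ forall c x y, f (c *: x + y) = c * f x + f y,
    forall w, W w -> f w = 0 & f v = 1].
Proof.
move=> Wsub Wv; have [M [[M0 Mlin] WM Mv Mmax]] := maximal_subspace Wsub Wv.
have MZ c x : M x -> M (c *: x) by move=> Mx; rewrite -[_ *: _]addr0; exact: Mlin.
have MB x y : M x -> M y -> M (x - y).
  by move=> Mx My; rewrite addrC -scaleN1r; exact: Mlin.
have /choice[f fM] : forall x, exists c, M (x - c *: v).
  move=> x; apply: contrapT => /forallNP nx; apply: Mv.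
  pose M' y := exists c z, M z /\ y = c *: x + z.
  suff M'v : M' v.
    have [c [z [Mz vE]]] := M'v; have [c0|c0] := eqVneq c 0.
      by rewrite vE c0 scale0r add0r.
    case: (nx c^-1); rewrite vE scalerDr scalerA mulVf // scale1r opprD addNKr.
    by rewrite -scaleN1r; apply/MZ/MZ.
  apply: contrapT => M'v; case: (nx 0); rewrite scale0r subr0.
  apply: (Mmax M') => //; first split.
  - by exists 0, 0; rewrite scale0r add0r.
  - move=> c y1 y2 [c1 [z1 [Mz1 ->]]] [c2 [z2 [Mz2 ->]]].
    exists (c * c1 + c2), (c *: z1 + z2); split; first exact: Mlin.
    by rewrite scalerDl scalerDr scalerA addrACA.
  - by move=> y My; exists 0, y; rewrite scale0r add0r.
  by exists 1, 0; rewrite scale1r addr0.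
have f_uniq x c : M (x - c *: v) -> f x = c.
  move=> Mc; apply/eqP; rewrite -subr_eq0; apply: contraT => ne; case: Mv.
  have E : x - c *: v - (x - f x *: v) = (f x - c) *: v.
    by rewrite opprB addrC addrA subrK -scalerBl.
  have := MZ (f x - c)^-1 _ (MB _ _ Mc (fM x)).
  by rewrite E scalerA mulVf // scale1r.
exists f; split=> [c x y|w Ww|]; apply: f_uniq.
- by rewrite scalerDl -scalerA opprD addrACA -scalerBr; exact: Mlin.
- by rewrite scale0r subr0; exact: WM.
- by rewrite scale1r subrr.
Qed.
End Separation.

(** * The Kronecker substitution *)
Lemma digits_inj M e (a b : 'I_e -> nat) :
  (forall i, a i < M)%N -> (forall i, b i < M)%N ->
  (\sum_i a i * M ^ i)%N = (\sum_i b i * M ^ i)%N -> a =1 b.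
Proof.
elim: e a b => [|e IH] a b aM bM; first by move=> _ [].
have step (c : 'I_e.+1 -> nat) : (\sum_i c i * M ^ i)%N =
    ((\sum_(i < e) c (lift ord0 i) * M ^ i) * M + c ord0)%N.
  rewrite big_ord_recl muln1 addnC; congr (_ + _)%N; rewrite big_distrl /=.
  by apply: eq_bigr => i _; rewrite -mulnA -expnSr.
rewrite !step => h.
have M0 : (0 < M)%N by apply: leq_ltn_trans (aM ord0).
have h0 : a ord0 = b ord0.
  by have := congr1 (modn^~ M) h; rewrite !modnMDl !modn_small.
have /IH h1 : (\sum_(i < e) a (lift ord0 i) * M ^ i)%N =
    (\sum_(i < e) b (lift ord0 i) * M ^ i)%N.
  by have := congr1 (divn^~ M) h; rewrite !divnMDl // !divn_small // !addn0.
move=> i; case: (unliftP ord0 i) => [k ->|-> //]; exact: h1.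
Qed.

Lemma size_sum_distinct (R : idomainType) (I : eqType) (s : seq I) (F : I -> {poly R}) :
  uniq s -> {in s &, injective (fun i => size (F i))} -> {in s, forall i, F i != 0} ->
  size (\sum_(i <- s) F i) = (\max_(i <- s) size (F i))%N.
Proof.
elim: s => [|x s IH] /=; first by rewrite !big_nil size_poly0.
move=> /andP[xs us] inj nz; rewrite !big_cons.
have nzs : {in s, forall i, F i != 0} by move=> i si; apply: nz; rewrite inE si orbT.
have {}IH : size (\sum_(i <- s) F i) = (\max_(i <- s) size (F i))%N.
  by apply: IH => // i j si sj; apply: inj; rewrite inE ?si ?sj orbT.
have ne : (\max_(i <- s) size (F i))%N != size (F x).
  have : s = [::] \/ exists2 i, i \in s & (\max_(i <- s) size (F i))%N = size (F i).
    elim: (s) => [|y t IHt]; [by left|right; rewrite big_cons].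
    case: IHt => [->|[i it ->]]; first by exists y; rewrite ?mem_head // big_nil maxn0.
    by case: leqP => _; [exists i; rewrite // inE it orbT|exists y; rewrite ?mem_head].
  case=> [->|[i si ->]]; first by rewrite big_nil eq_sym size_poly_eq0 nz ?mem_head.
  apply: contraNneq xs => /inj <- //; rewrite ?mem_head // inE si orbT //.
have [lt|lt|eq] := ltngtP (size (\sum_(i <- s) F i)) (size (F x)).
- by rewrite size_polyDl // (maxn_idPl _) // -IH ltnW.
- by rewrite addrC size_polyDl // IH (maxn_idPr _) // -IH ltnW.
- by rewrite -IH eq eqxx in ne.
Qed.

(** With M above all exponents, the substitution of y_i + X^(M^i) for the i-th
    variable sends distinct monomials to polynomials of distinct degrees (digits
    in base M), so nothing cancels; the shift by y does not affect degrees. *)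
Lemma kronecker_neq0 (L : fieldType) e (s : seq 'X_{1..e}) (c : 'X_{1..e} -> L)
    (y : 'I_e -> L) M : uniq s -> s != [::] ->
  {in s, forall m, c m != 0 /\ forall i, (m i < M)%N} ->
  \sum_(m <- s) (c m)%:P * \prod_i ((y i)%:P + 'X^(M ^ i)) ^+ m i != 0.
Proof.
move=> us s0 sP.
pose T (m : 'X_{1..e}) := (c m)%:P * \prod_i ((y i)%:P + 'X^(M ^ i)) ^+ m i.
have szT m : m \in s -> size (T m) = (\sum_i m i * M ^ i).+1.
  move=> sm; have [cm mM] := sP m sm.
  have prod_monic : \prod_i ((y i)%:P + 'X^(M ^ i)) ^+ m i \is monic /\
    size (\prod_i ((y i)%:P + 'X^(M ^ i)) ^+ m i) = (\sum_i m i * M ^ i).+1.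
    apply: (big_rec2 (fun (p : {poly L}) k => p \is monic /\ size p = k.+1)).
      by rewrite monic1 size_poly1.
    move=> i k p _ [pm sp].
    have M0 : (0 < M ^ i)%N by rewrite expn_gt0 (leq_ltn_trans _ (mM i)).
    have xm : ((y i)%:P + 'X^(M ^ i)) \is monic.
      by rewrite addrC monicXnaddC.
    have xs : size ((y i)%:P + 'X^(M ^ i)) = (M ^ i).+1 by rewrite addrC size_XnaddC.
    split; first by rewrite rpredM ?rpredX.
    have xms : size (((y i)%:P + 'X^(M ^ i)) ^+ m i) = (m i * M ^ i).+1.
      have e0 : (0 < size (((y i)%:P + 'X^(M ^ i)) ^+ m i))%N.
        by rewrite lt0n size_poly_eq0 expf_neq0 ?monic_neq0.
      by rewrite -(prednK e0) size_exp xs mulnC.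
    by rewrite size_monicM ?monic_exp ?monic_neq0 // xms sp addSn addnS.
  by rewrite /T mul_polyC size_scale //; case: prod_monic.
rewrite -size_poly_eq0 (size_sum_distinct us).
- case: s s0 us sP szT => // m s _ _ _ szT; rewrite big_cons -lt0n leq_max.
  by rewrite -/(T m) szT ?mem_head.
- move=> m m' sm sm'; rewrite -/(T m) -/(T m') !szT // => -[h].
  by apply/eqP/cmP; apply: digits_inj h; [case: (sP m sm)|case: (sP m' sm')].
- by move=> m sm; rewrite -/(T m) -size_poly_eq0 szT.
Qed.

(** * Morphisms out of the ring of differential polynomials *)
Section MonomialValue.
Variables (I : choiceType) (S : comNzRingType) (g : I -> S).

Definition monomial_value (m : {cmonom I}) : S := \prod_(i <- finsupp m) g i ^+ m i.

Lemma monomial_valueEw (E : {fset I}) (m : {cmonom I}) : (finsupp m `<=` E)%fset ->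
  monomial_value m = \prod_(i <- E) g i ^+ m i.
Proof.
by move=> le; apply: big_fset_incl le _ => i _; rewrite -cmE_eq0 => /eqP->.
Qed.

Lemma monomial_value_mmorphism : monalg.mmorphism monomial_value.
Proof.
split=> [x y|]; last by rewrite /monomial_value mdom1 big_seq_fset0.
rewrite /monomial_value [in LHS]mdomD.
rewrite -/(monomial_value x) -/(monomial_value y).
rewrite (monomial_valueEw (fsubsetUl _ (finsupp y))).
rewrite (monomial_valueEw (fsubsetUr (finsupp x) _)).
by rewrite -big_split; apply: eq_bigr => i _; rewrite cmM exprD.
Qed.

HB.instance Definition _ := monalg.isMultiplicative.Build {cmonom I} S
  monomial_value monomial_value_mmorphism.
End MonomialValue.

Section Kernel.
Variables (R : comNzRingType) (S : idomainType) (phi : {rmorphism R -> S}).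

Definition ring_kernel (x : R) : bool := phi x == 0.

Lemma ring_kernel_idealr : idealr_closed ring_kernel.
Proof.
split; rewrite ?unfold_in /ring_kernel ?rmorph0 ?rmorph1 ?oner_eq0 // => a x y.
by rewrite !unfold_in => /eqP xk /eqP yk; rewrite rmorphD rmorphM xk yk mulr0 addr0.
Qed.

Lemma ring_kernel_prime : prime_idealr_closed ring_kernel.
Proof. by move=> x y; rewrite !unfold_in /ring_kernel rmorphM mulf_eq0. Qed.

HB.instance Definition _ := isIdealr.Build R ring_kernel ring_kernel_idealr.
HB.instance Definition _ := isPrimeIdealrClosed.Build R ring_kernel ring_kernel_prime.
End Kernel.

Section Dpoly.
Variables (K : fieldType) (n : nat).

(** Restricting the variables with E gives control on which ones are used: it
    serves to locate the value of f in the ring generated by finitely many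
    coordinates. *)
Lemma dpoly_ind (Q : dpoly K n -> Prop) (E : pred ('I_n * nat)) :
  (forall c, Q c%:MP) -> (forall p q, Q p -> Q q -> Q (p + q)) ->
  (forall p v, E v -> Q p -> Q (p * dX K v)) ->
  forall f : dpoly K n, (forall m v, m \in msupp f -> v \in finsupp m -> E v) -> Q f.
Proof.
move=> QC QD QX f fE; rewrite [f]monalgE big_seq; apply: big_ind => //.
  by have := QC 0; rewrite malgC0E.
move=> m /fE; move: (f@_m) => c {f fE} mE.
have [k] := ubnP (mdeg m); elim: k m mE => // k IH m mE; rewrite ltnS => mk.
have [->|m1] := eqVneq m (onecm _); first exact: QC.
have [v vm] : exists v, v \in finsupp m.
  apply/fset0Pn; apply: contra_neq m1 => m0; apply/eqP/cmP => v.
  by rewrite onecmE; apply/eqP; rewrite cmE_eq0 m0.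
pose m' := divcm m (ucm v).
have mm' : m = mulcm m' (ucm v).
  apply/eqP/cmP => w; rewrite mulcmE divcmE ucmE.
  case: eqP => [<-|_] /=; last by rewrite subn0 addn0.
  by rewrite subnK // lt0n cmE_neq0.
have -> : << c *g m >> = << c *g m' >> * dX K v.
  rewrite {1}mm' -[c in LHS]mulr1; exact: (esym (fgmulUU _ _ _ _)).
apply: QX; first exact: (mE v).
apply: IH => [w wm'|].
  by apply: mE; rewrite mm' mdomD inE wm'.
by apply: leq_trans mk; rewrite [in (_ < _)%N]mm' mdegM mdegU addn1.
Qed.

End Dpoly.

(** * Linear differential polynomials *)
Section FormLift.
Variables (K : fieldType) (n : nat) (W : lmodType K) (F : 'I_n * nat -> W).
Local Notation V := {ffun 'I_n -> {poly K}}.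

(** A homogeneous linear form is encoded by one operator per unknown: q stands
    for the sum of the (q j)`_r x_j^(r). [form_lift] is the linear map defined by
    the images F of the variables. *)
Definition form_lift (q : V) : W :=
  \sum_j \sum_(r < size (q j)) (q j)`_r *: F (j, r : nat).

Lemma form_lift_widen (q : V) (l : 'I_n -> nat) : (forall j, size (q j) <= l j)%N ->
  form_lift q = \sum_j \sum_(r < l j) (q j)`_r *: F (j, r : nat).
Proof.
move=> ql; apply: eq_bigr => j _.
rewrite (big_ord_widen (l j) (fun r => (q j)`_r *: F (j, r))) // big_mkcond.
by apply: eq_bigr => r _; case: ltnP => // h; rewrite nth_default // scale0r.
Qed.

Lemma form_lift_widen_const (q : V) N : (forall j, size (q j) <= N)%N ->
  form_lift q = \sum_j \sum_(r < N) (q j)`_r *: F (j, r : nat).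
Proof. exact: (@form_lift_widen q (fun=> N)). Qed.

Lemma form_bound (q : V) : exists N, forall j, (size (q j) <= N)%N.
Proof.
exists (\max_j size (q j))%N => j.
exact: (leq_bigmax (F := fun j => size (q j))).
Qed.

End FormLift.

Section LinearForms.
Variables (K : fieldType) (n : nat).
Local Notation V := {ffun 'I_n -> {poly K}}.

Definition var_form (v : 'I_n * nat) : V :=
  [ffun j => if j == v.1 then 'X^(v.2) else 0].

Lemma form_expand (q : V) : form_lift var_form q = q.
Proof.
have [N qN] := form_bound q; rewrite (form_lift_widen_const _ qN).
apply/ffunP => j; rewrite sum_ffunE (bigD1 j) //= [X in _ + X]big1 ?addr0; last first.
  move=> i ij; rewrite sum_ffunE big1 // => r _.
  by rewrite !ffunE /= eq_sym (negPf ij) scaler0.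
rewrite sum_ffunE; apply/polyP => k; rewrite coef_sum.
have [hk|hk] := ltnP k N; last first.
  rewrite [RHS]nth_default ?(leq_trans (qN j)) // big1 // => r _.
  rewrite !ffunE eqxx coefZ coefXn; case: eqP => [/= e|]; rewrite ?mulr0 //.
  by have := ltn_ord r; rewrite -e ltnNge hk.
rewrite (bigD1 (Ordinal hk)) //= big1 ?addr0.
  by rewrite !ffunE eqxx coefZ coefXn eqxx mulr1.
move=> r rk; rewrite !ffunE eqxx coefZ coefXn; case: eqP; rewrite ?mulr0 //= => e.
by case/eqP: rk; apply: val_inj.
Qed.

Definition form_poly (q : V) : dpoly K n := form_lift (@dX K n) q.

Definition linear_part (u : dpoly K n) : V :=
  [ffun j => \poly_(r < dbound u) u@_(ucm (j, r : nat))].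

Lemma coef_linear_part u j r : (linear_part u j)`_r = u@_(ucm (j, r)).
Proof.
rewrite ffunE coef_poly; case: ltnP => // h; apply: esym; apply: mcoeff_outdom.
apply: contraL h => uv; rewrite -ltnNge; apply: (@dbound_pderiv _ _ _ j).
have cE : (pderiv (j, r) u)@_(onecm _) = u@_(ucm (j, r)).
  by rewrite mcoeff_pderiv mul0cm onecmE mulr1n.
by apply: contraTneq uv => p0; rewrite -mcoeff_neq0 -cE p0 mcoeff0 eqxx.
Qed.

Lemma dX_coef (v w : 'I_n * nat) : (dX K v)@_(ucm w) = (v == w)%:R.
Proof.
rewrite /dX mcoeffU; congr (nat_of_bool _)%:R; apply/eqP/eqP => [|->//].
move/(congr1 (fun m : {cmonom ('I_n * nat)%type} => m w)); rewrite !ucmE eqxx.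
by case: eqP.
Qed.

Lemma form_poly_coef (q : V) N (m : {cmonom ('I_n * nat)%type}) :
  (forall j, size (q j) <= N)%N ->
  (form_poly q)@_m = \sum_j \sum_(r < N) (q j)`_r * (dX K (j, r : nat))@_m.
Proof.
move=> qN; rewrite /form_poly (form_lift_widen_const _ qN) raddf_sum.
apply: eq_bigr => j _.
by rewrite raddf_sum; apply: eq_bigr => r _; exact: mcoeffZ.
Qed.

Lemma form_poly_coef_var (q : V) j r : (form_poly q)@_(ucm (j, r)) = (q j)`_r.
Proof.
have [N qN] := form_bound q; rewrite (form_poly_coef _ qN).
rewrite (eq_bigr (fun i =>
  \sum_(s < N) (q i)`_s * ((i, s : nat) == (j, r))%:R)); last first.
  by move=> i _; apply: eq_bigr => s _; rewrite dX_coef.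
rewrite (bigD1 j) //= [X in _ + X]big1 ?addr0; last first.
  by move=> i ij; rewrite big1 // => s _; rewrite xpair_eqE (negPf ij) mulr0.
have [hr|hr] := ltnP r N.
  rewrite (bigD1 (Ordinal hr)) //= eqxx mulr1 big1 ?addr0 // => s sr.
  rewrite xpair_eqE eqxx; case: eqP => [e1|]; rewrite ?mulr0 //.
  by case/eqP: sr; apply: val_inj.
rewrite nth_default ?(leq_trans (qN j)) // big1 // => s _.
rewrite xpair_eqE eqxx; case: eqP => [e1|]; rewrite ?mulr0 //.
by have := ltn_ord s; rewrite e1 ltnNge hr.
Qed.

Lemma form_poly_coef_out (q : V) (m : {cmonom ('I_n * nat)%type}) :
  (forall v, m <> ucm v) -> (form_poly q)@_m = 0.
Proof.
move=> mv; have [N qN] := form_bound q; rewrite (form_poly_coef _ qN).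
rewrite big1 // => j _; rewrite big1 // => r _.
by rewrite /dX mcoeffU; case: eqP => [e|]; [case: (mv (j, r : nat))|rewrite mulr0].
Qed.

(** A monomial of degree at most 1 is either 1 or a variable. *)
Lemma dlinear_decomp u :
  dlinear u -> u = (u@_(onecm _))%:MP + form_poly (linear_part u).
Proof.
move=> lu; apply/malgP => m; rewrite mcoeffD mcoeffC.
have [[[j r] ->]|ne] := pselect (exists v, m = ucm v).
  rewrite form_poly_coef_var coef_linear_part.
  have /negPf -> : ucm (j, r) != onecm _ :> {cmonom ('I_n * nat)%type}.
    by rewrite -mdeg_eq0 mdegU.
  by rewrite mulr0n add0r.
rewrite form_poly_coef_out => [|v mv]; last by apply: ne; exists v.
rewrite addr0; have [->|m1] := eqVneq m (onecm _); first by rewrite mulr1n.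
rewrite mulr0n; apply: mcoeff_outdom; apply/negP => mu; apply: ne.
have [v vm] : exists v, v \in finsupp m.
  apply/fset0Pn; apply: contra_neq m1 => m0; apply/eqP/cmP => v.
  by rewrite onecmE; apply/eqP; rewrite cmE_eq0 m0.
exists v; have mm' : m = mulcm (divcm m (ucm v)) (ucm v).
  apply/eqP/cmP => w; rewrite mulcmE divcmE ucmE.
  case: eqP => [<-|_] /=; last by rewrite subn0 addn0.
  by rewrite subnK // lt0n cmE_neq0.
have := lu m mu; rewrite [in (_ <= _)%N]mm' mdegM mdegU addn1 ltnS leqn0.
rewrite mdeg_eq0 => /eqP d1.
by rewrite mm' d1 mul0cm.
Qed.
End LinearForms.

Section FormDerivation.
Variables (K : fieldType) (delta : K -> K) (hdelta : is_derivation delta) (n : nat).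
Local Notation V := {ffun 'I_n -> {poly K}}.
Let delta0 := derivation0 hdelta.

Definition form_D (q : V) : V := [ffun j => opD delta (q j)].

Lemma iter_form_D k (q : V) j : iter k form_D q j = iter k (opD delta) (q j).
Proof. by elim: k => //= k IH; rewrite ffunE IH. Qed.

(** Stated for any target with a derivation-like map, so that the computation is
    done in an abstract module. *)
Lemma form_lift_D (W : lmodType K) (F : 'I_n * nat -> W) (dW : W -> W) (q : V) :
  (forall x y, dW (x + y) = dW x + dW y) ->
  (forall c x, dW (c *: x) = delta c *: x + c *: dW x) ->
  (forall v, dW (F v) = F (vnext v)) ->
  dW (form_lift F q) = form_lift F (form_D q).
Proof.
move=> dWD dWZ dWF.
have dW0 : dW 0 = 0 by rewrite -(scale0r 0) dWZ delta0 !scale0r addr0.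
have [N qN] := form_bound q.
rewrite (form_lift_widen_const _ qN).
rewrite (@form_lift_widen_const _ _ _ F (form_D q) N.+1); last first.
  by move=> j; rewrite ffunE; exact: size_opD.
rewrite (big_morph dW dWD dW0); apply: eq_bigr => j _.
rewrite (big_morph dW dWD dW0) [RHS](eq_bigr (fun r : 'I_N.+1 =>
  (if r : nat is r'.+1 then (q j)`_r' else 0) *: F (j, r : nat)
  + delta (q j)`_r *: F (j, r : nat))).
  rewrite [RHS]big_split /= big_ord_recl scale0r add0r big_ord_recr /=.
  rewrite [(q j)`_N]nth_default ?qN // delta0 scale0r addr0 addrC -big_split /=.
  by apply: eq_bigr => r _; rewrite dWZ dWF.
by move=> r _; rewrite ffunE coef_opD // scalerDl.
Qed.

Lemma ddiff_form_poly (q : V) : ddiff delta (form_poly q) = form_poly (form_D q).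
Proof.
apply: form_lift_D => [x y|c x|v].
- exact: (ddiff_derivation n hdelta).1.
- by rewrite -!mul_malgC (ddiff_derivation n hdelta).2 ddiffC.
- exact: ddiffX.
Qed.

Lemma iter_ddiff_affine k c (q : V) :
  iter k (ddiff delta) (c%:MP + form_poly q) =
  (iter k delta c)%:MP + form_poly (iter k form_D q).
Proof.
elim: k => //= k ->; rewrite (ddiff_derivation n hdelta).1 ddiffC //.
by rewrite ddiff_form_poly.
Qed.
End FormDerivation.
Arguments form_D {K} delta {n} q.

Section Morphisms.
Variables (K : fieldType) (n : nat).
Local Notation V := {ffun 'I_n -> {poly K}}.

Lemma rmorph_form_poly_widen (S : comNzRingType) (phi : {rmorphism dpoly K n -> S})
    (q : V) (l : 'I_n -> nat) : (forall j, size (q j) <= l j)%N ->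
  phi (form_poly q) =
  \sum_j \sum_(r < l j) phi ((q j)`_r)%:MP * phi (dX K (j, r : nat)).
Proof.
move=> ql; rewrite /form_poly (form_lift_widen _ ql) rmorph_sum; apply: eq_bigr => j _.
rewrite rmorph_sum; apply: eq_bigr => r _.
by rewrite -mul_malgC; exact: rmorphM.
Qed.

Lemma rmorph_form_poly (S : comNzRingType) (phi : {rmorphism dpoly K n -> S})
    (q : V) N :
  (forall j, size (q j) <= N)%N ->
  phi (form_poly q) =
  \sum_j \sum_(r < N) phi ((q j)`_r)%:MP * phi (dX K (j, r : nat)).
Proof. exact: (@rmorph_form_poly_widen S phi q (fun=> N)). Qed.

Lemma linear_expand (W : lmodType K) (h : V -> W) (q : V) :
  (forall c x y, h (c *: x + y) = c *: h x + h y) ->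
  h q = form_lift (fun v => h (var_form K v)) q.
Proof.
move=> hlin; have h0 : h 0 = 0.
  have /eqP := hlin 1 0 0; rewrite scaler0 addr0 scale1r -subr_eq subrr eq_sym.
  by move/eqP.
have hD x y : h (x + y) = h x + h y by rewrite -[x]scale1r hlin !scale1r.
have hZ c x : h (c *: x) = c *: h x by rewrite -[_ *: x]addr0 hlin h0 addr0.
rewrite -{1}(form_expand q) /form_lift (big_morph h hD h0); apply: eq_bigr => j _.
by rewrite (big_morph h hD h0); apply: eq_bigr => r _; rewrite hZ.
Qed.
Lemma rmorph_mmapC (S : comNzRingType) (phi : {rmorphism dpoly K n -> S}) e
    (g : 'I_e -> dpoly K n) (p : {mpoly K[e]}) :
  phi (mmap (@malgC _ K) (fun m : 'X_{1..e} => \prod_i g i ^+ m i) p) =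
  \sum_(m <- msupp p) phi (p@_m)%:MP * \prod_i phi (g i) ^+ m i.
Proof.
rewrite /mmap rmorph_sum; apply: eq_bigr => m _.
rewrite rmorphM rmorph_prod; congr (_ * _); apply: eq_bigr => i _.
exact: rmorphXn.
Qed.
End Morphisms.

(** * The residue field *)
Lemma fraction_ratio (R : idomainType) (x : {fraction R}) :
  exists n d, d != 0 /\ x * FracField.tofrac d = FracField.tofrac n.
Proof.
elim/quotW: x => x; exists (frac x).1, (frac x).2; split; first exact: denom_ratioP.
unlock FracField.tofrac; rewrite -[LHS]FracField.pi_mul; apply/eqmodP => /=.
rewrite /FracField.equivf /FracField.mulf.
by rewrite !numden_Ratio ?oner_neq0 ?mulr1 ?mulf_neq0 ?denom_ratioP // mulrC.
Qed.

Section ResidueMap.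
Variables (R : comNzRingType) (P : prime_idealr R).

Lemma residue_map_eq0 f : (residue_map P f == 0) = (f \in P).
Proof.
rewrite /residue_map /= tofrac_eq0 /quot_proj.
rewrite -[f in RHS]subr0 Quotient.idealrBE.
by rewrite -(rmorph0 (quot_proj P)); apply/eqP/eqP.
Qed.

Lemma residue_field_ratio (x : residue_field P) :
  exists f g, residue_map P g != 0 /\ x * residue_map P g = residue_map P f.
Proof.
have [a [b [b0 xab]]] := fraction_ratio x.
elim/quotW: b b0 xab => b b0 xab; elim/quotW: a xab => a xab.
by exists a, b; split; rewrite ?tofrac_eq0.
Qed.
End ResidueMap.

(** * Translating the generic point of a component *)
Section IdealKernel.
Variables (K : fieldType) (n : nat).

Lemma dpoly_rmorph_ext (S : comNzRingType) (phi psi : {rmorphism dpoly K n -> S}) :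
  (forall c, phi c%:MP = psi c%:MP) -> (forall v, phi (dX K v) = psi (dX K v)) ->
  phi =1 psi.
Proof.
move=> hC hX f.
apply: (@dpoly_ind K n (fun f => phi f = psi f) predT) => // [p q hp hq|p v _ hp].
  by rewrite !rmorphD hp hq.
by rewrite !rmorphM hp hX.
Qed.

Variables (delta : K -> K) (hdelta : is_derivation delta) (u : 'I_n -> dpoly K n).

(** The f all of whose derivatives are killed by phi form a differential ideal,
    even though phi does not commute with any derivation. *)
Lemma diff_ideal_gen_kernel (S : comNzRingType) (phi : {rmorphism dpoly K n -> S}) f :
  (forall i k, phi (iter k (ddiff delta) (u i)) = 0) ->
  diff_ideal_gen delta u f -> phi f = 0.
Proof.
move=> hu If; rewrite -[f]/(iter 0 (ddiff delta) f); move: 0%N.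
apply: (If (fun f => forall k, phi (iter k (ddiff delta) f) = 0)); last by [].
have dD := (ddiff_derivation n hdelta).1; have dM := (ddiff_derivation n hdelta).2.
have iterD k p q : iter k (ddiff delta) (p + q) =
    iter k (ddiff delta) p + iter k (ddiff delta) q :> dpoly K n.
  by elim: k => //= k ->; rewrite dD.
split=> [k|p q hp hq k|p q hq k|p hp k].
- have d0 : ddiff delta 0 = 0 :> dpoly K n by rewrite /ddiff msupp0 big_seq_fset0.
  have -> : iter k (ddiff delta) 0 = 0 :> dpoly K n.
    by elim: k => [//|k IH]; rewrite iterS IH d0.
  exact: rmorph0.
- by rewrite iterD rmorphD hp hq addr0.
- elim: k p q hq => [|k IH] p q hq.
    by have := hq 0%N; rewrite /= rmorphM => ->; rewrite mulr0.
  have E1 : phi (iter k (ddiff delta) (ddiff delta p * q)) = 0 by exact: IH.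
  have E2 : phi (iter k (ddiff delta) (p * ddiff delta q)) = 0.
    by apply: IH => m; rewrite -iterSr; exact: hq.
  by rewrite iterSr dM iterD rmorphD; exact: etrans (congr2 +%R E1 E2) (addr0 _).
- by rewrite -iterSr; exact: hp.
Qed.
End IdealKernel.

(** The residue field enters only through a morphism eta to some field L with
    kernel P. *)
Section Component.
Variables (K : fieldType) (delta : K -> K) (hdelta : is_derivation delta).
Variables (n : nat) (u : 'I_n -> dpoly K n) (hu : forall i, dlinear (u i)).
Variables (P : prime_idealr (dpoly K n)).
Hypothesis hP : is_minimal_prime_over (diff_ideal_gen delta u) P.
Variables (L : fieldType) (eta : {rmorphism dpoly K n -> L}).
Hypothesis eta_eq0 : forall f, (eta f == 0) = (f \in P).
Local Notation V := {ffun 'I_n -> {poly K}}.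
Local Notation iota := (eta \o malgC).

Lemma residue_iter_eq0 i k : eta (iter k (ddiff delta) (u i)) = 0.
Proof.
apply/eqP; rewrite eta_eq0; apply: hP.1 => I [I0 ID IM Id] Iu.
by elim: k => [|k IH] /=; [exact: Iu|exact: Id].
Qed.

Lemma residue_iter_linear_part i k : exists b : K,
  eta (form_poly (iter k (form_D delta) (linear_part (u i)))) = iota b.
Proof.
have := residue_iter_eq0 i k.
rewrite [X in iter k _ X](dlinear_decomp (@hu i)) (iter_ddiff_affine hdelta).
rewrite rmorphD => /eqP; rewrite addrC addr_eq0 => /eqP ->.
by exists (- iter k delta (u i)@_(onecm _)); rewrite rmorphN.
Qed.

(** Here h packs several solutions of the homogeneous system in one polynomial:
    its coefficients are functionals on linear forms that vanish on all
    derivatives of the equations. *)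
Section Translation.
Variable h : V -> {poly K}.
Hypothesis hlin : forall c x y, h (c *: x + y) = c *: h x + h y.
Hypothesis h_sol : forall i k, h (iter k (form_D delta) (linear_part (u i))) = 0.
Hypothesis h_coef0 : forall v, (h (var_form K v))`_0 = 0.

Definition moving_point (v : 'I_n * nat) : {poly L} :=
  (eta (dX K v))%:P + map_poly iota (h (var_form K v)).

Definition translate : dpoly K n -> {poly L} :=
  mmap (polyC \o iota) (monomial_value moving_point).
HB.instance Definition _ := GRing.RMorphism.on translate.

Lemma translateC c : translate c%:MP = (iota c)%:P.
Proof. exact: mmapC. Qed.

Lemma translateX v : translate (dX K v) = moving_point v.
Proof.
rewrite /translate /dX mmapU /= rmorph1 polyC1 mul1r /monomial_value mdomU.
by rewrite big_seq_fset1 cmUU expr1.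
Qed.

Lemma translate_form_poly (q : V) :
  translate (form_poly q) = (eta (form_poly q))%:P + map_poly iota (h q).
Proof.
have [N qN] := form_bound q.
pose c j (r : 'I_N) : {poly L} := (iota (q j)`_r)%:P.
have E0 : translate (form_poly q) =
    \sum_j \sum_(r < N) c j r * moving_point (j, r : nat).
  rewrite (rmorph_form_poly translate qN); apply: eq_bigr => j _.
  by apply: eq_bigr => r _; exact: (congr2 *%R (translateC _) (translateX _)).
have E1 : (eta (form_poly q))%:P =
    \sum_j \sum_(r < N) c j r * (eta (dX K (j, r : nat)))%:P.
  rewrite (rmorph_form_poly eta qN) rmorph_sum; apply: eq_bigr => j _ /=.
  by rewrite rmorph_sum; apply: eq_bigr => r _; rewrite /= polyCM.
have E2 : map_poly iota (h q) =
    \sum_j \sum_(r < N) c j r * map_poly iota (h (var_form K (j, r : nat))).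
  rewrite (linear_expand q hlin) (form_lift_widen_const _ qN) rmorph_sum.
  apply: eq_bigr => j _.
  rewrite rmorph_sum; apply: eq_bigr => r _.
  by rewrite -mul_polyC rmorphM /= map_polyC.
rewrite E0 E1 E2 -big_split; apply: eq_bigr => j _.
by rewrite -big_split; apply: eq_bigr => r _; exact: mulrDr.
Qed.

(** At parameter 0 the moving point is the generic point: so the kernel of
    [translate] lies in P. *)
Lemma translate_at0 f : (translate f).[0] = eta f.
Proof.
apply: (@dpoly_rmorph_ext K n L (horner_eval 0 \o translate) eta) => [c|v] /=.
  by rewrite translateC /horner_eval hornerC.
rewrite translateX /horner_eval hornerD hornerC.
by rewrite horner_coef0 coef_map h_coef0 raddf0 addr0.
Qed.

Lemma translate_diff_ideal f : diff_ideal_gen delta u f -> translate f = 0.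
Proof.
apply: (diff_ideal_gen_kernel hdelta (phi := translate)) => i k.
have := residue_iter_eq0 i k; rewrite [X in iter k _ X](dlinear_decomp (@hu i)).
rewrite (iter_ddiff_affine hdelta) !rmorphD.
rewrite /= translateC translate_form_poly h_sol.
by rewrite rmorph0 addr0 -polyCD => ->.
Qed.

(** The kernel of [translate] is prime, contains [u] and lies in P; minimality
    of P gives the reverse inclusion. *)
Lemma translate_component f : f \in P -> translate f = 0.
Proof.
move=> fP; apply/eqP.
apply: (hP.2 (ring_kernel translate) _ _ f fP) => [p Ip|p].
  by apply/eqP; exact: translate_diff_ideal.
move/eqP => /= p0; rewrite -eta_eq0 -translate_at0.
by rewrite [translate p]p0 horner0.
Qed.
End Translation.

(** Otherwise the row module contains no nonzero operator in x_j alone, so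
    x_j^(r) is not in the span of the rows and of the x_j^(s), s <> r. For each
    r <= d a functional f_r kills the rows and the x_j^(s), s <> r, and is 1 at
    x_j^(r). Moving the generic point by sum_r f_r X^(M^r) turns an algebraic
    relation between x_j, ..., x_j^(d) into its Kronecker substitution, which
    must vanish by invariance of the component. *)
Lemma component_torsion d (j : 'I_n) :
  (forall t : 'I_d.+1 -> L, ~ alg_independent iota t) ->
  exists2 q : 'I_n -> {poly K},
    \sum_i opmul delta (q i) (linear_part (u i) j) != 0 &
    forall j', j' != j -> \sum_i opmul delta (q i) (linear_part (u i) j') = 0.
Proof.
move=> dep; apply: contrapT => free.
pose Phi (q : 'I_n -> {poly K}) j' := \sum_i opmul delta (q i) (linear_part (u i) j').
have Phi_lin c q q' j' : Phi (fun i => c *: q i + q' i) j' = c *: Phi q j' + Phi q' j'.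
  rewrite /Phi scaler_sumr -big_split; apply: eq_bigr => i _.
  by rewrite opmulDl opmulZl.
have Phi0 j' : Phi (fun=> 0) j' = 0 by rewrite /Phi big1 // => i _; rewrite opmul0l.
(* W r is the row module plus the span of the x_j^(s), s <> r. *)
pose W r (x : V) := exists q,
  (forall j', j' != j -> x j' = Phi q j') /\ (x j - Phi q j)`_r = 0.
have Wsub r : is_subspace (W r).
  split=> [|c x y [q [qx qr]] [q' [qy qr']]].
    by exists (fun=> 0); split=> [j' _|]; rewrite Phi0 ffunE ?subr0 ?coef0.
  exists (fun i => c *: q i + q' i); split=> [j' jj'|].
    by rewrite Phi_lin !ffunE qx // qy.
  rewrite Phi_lin !ffunE opprD addrACA -scalerBr coefD coefZ qr qr'.
  by rewrite mulr0 addr0.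
have Wvar r s : s != r -> W r (var_form K (j, s)).
  move=> sr; exists (fun=> 0); split=> [j' jj'|].
    by rewrite Phi0 ffunE (negPf jj').
  by rewrite Phi0 subr0 ffunE eqxx coefXn eq_sym (negPf sr).
have WvarN r : ~ W r (var_form K (j, r)).
  move=> [q [qj' qr]]; have Pj : Phi q j = 0.
    apply/eqP; apply: contraT => Pj; case: free; exists q => // j' jj'.
    by rewrite -/(Phi q j') -qj' // ffunE (negPf jj').
  move: qr; rewrite Pj subr0 ffunE eqxx coefXn eqxx => /eqP.
  by rewrite oner_eq0.
have Wsol r i k : W r (iter k (form_D delta) (linear_part (u i))).
  exists (fun i' => if i' == i then 'X^k else 0).
  have E j' : iter k (form_D delta) (linear_part (u i)) j' =
      Phi (fun i' => if i' == i then 'X^k else 0) j'.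
    rewrite /Phi (bigD1 i) //= eqxx opmulXn big1 ?addr0 ?iter_form_D // => i' ii'.
    by rewrite (negPf ii') opmul0l.
  by split=> [j' _|]; [exact: E|rewrite E subrr coef0].
have /choice[f fP] : forall r : 'I_d.+1, exists f : V -> K,
   [/\ forall c x y, f (c *: x + y) = c * f x + f y,
    forall w, W r w -> f w = 0 & f (var_form K (j, r : nat)) = 1].
  by move=> r; apply: separating_functional.
pose t (r : 'I_d.+1) := eta (dX K (j, r : nat)).
have /existsNP[p /not_implyP[pt p0]] := dep t.
pose M := (\max_(m <- msupp p) \max_i m i).+1.
have mM m i : m \in msupp p -> (m i < M)%N.
  move=> mp; rewrite ltnS; apply: (@leq_trans (\max_i m i)).
    exact: (leq_bigmax (F := fun i => m i)).
  exact: (@leq_bigmax_seq _ (enum_fset (msupp p)) xpredT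
    (fun m : 'X_{1..d.+1} => \max_i m i)%N m mp isT).
pose h (q : V) := \sum_r f r q *: 'X^(M ^ (r : 'I_d.+1)).
have hlin c x y : h (c *: x + y) = c *: h x + h y.
  rewrite /h scaler_sumr -big_split; apply: eq_bigr => r _.
  by have [-> _ _] := fP r; rewrite scalerDl scalerA.
have h_sol i k : h (iter k (form_D delta) (linear_part (u i))) = 0.
  rewrite /h big1 // => r _; have [_ fW _] := fP r.
  by rewrite fW ?scale0r.
have h_coef0 v : (h (var_form K v))`_0 = 0.
  rewrite /h coef_sum big1 // => r _; rewrite coefZ coefXn.
  by rewrite eq_sym -[_ == _]negbK -lt0n expn_gt0 mulr0.
have h_var (s : 'I_d.+1) : h (var_form K (j, s : nat)) = 'X^(M ^ s).
  rewrite /h (bigD1 s) //= [X in _ + X]big1 ?addr0.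
    by have [_ _ ->] := fP s; rewrite scale1r.
  move=> r rs; have [_ fW _] := fP r; rewrite fW ?scale0r //.
  by apply: Wvar; rewrite eq_sym.
pose p' : dpoly K n := mmap (@malgC _ K)
    (fun m : 'X_{1..d.+1} => \prod_(i < d.+1) dX K (j, i : nat) ^+ m i) p.
have p'P : p' \in P.
  by rewrite -eta_eq0 /p' rmorph_mmapC; apply/eqP.
have /eqP := translate_component hlin h_sol h_coef0 p'P.
apply/negP; rewrite /p' (rmorph_mmapC (translate h)).
rewrite (eq_bigr (fun m => (iota p@_m)%:P * \prod_i ((t i)%:P + 'X^(M ^ i)) ^+ m i)).
  apply: kronecker_neq0; first exact: fset_uniq.
    apply: contra_notN p0 => /eqP e; apply/eqP; rewrite -msupp_eq0.
    by apply/eqP/fsetP => m; rewrite in_fset0 -[LHS]/(m \in enum_fset (msupp p)) e.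
  move=> m mp; split=> [|i]; last exact: mM.
  by rewrite fmorph_eq0 mcoeff_neq0.
move=> m _; congr (_ * _); first exact: translateC.
apply: eq_bigr => i _; congr (_ ^+ _); apply: etrans (translateX _ _) _.
by rewrite /moving_point h_var map_polyXn.
Qed.
End Component.

(** * The bound on the transcendence degree *)
Section DimBound.
Variables (K : fieldType) (delta : K -> K) (hdelta : is_derivation delta) (n : nat).
Variables (L : fieldType) (eta : {rmorphism dpoly K n -> L}).
Local Notation V := {ffun 'I_n -> {poly K}}.
Local Notation iota := (eta \o malgC).
Let delta0 := derivation0 hdelta.

(** The derivatives of order < m i of the i-th row only involve the x_j^(r) with
    r < l j, by the size condition, and they are independent; each is a relation
    with a value in K at the point eta. *)
Lemma transcendence_bound (A : 'I_n -> V) (m l : 'I_n -> nat) d (t : 'I_d -> L) :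
  (forall i k, exists b : K, eta (form_poly (iter k (form_D delta) (A i))) = iota b) ->
  (forall i j, A i j != 0 -> (size (A i j) + m i <= (l j).+1)%N) ->
  (forall p : 'I_n -> {poly K},
    (forall j, \sum_i opmul delta (p i) (A i j) = 0) -> forall i, p i = 0) ->
  (forall i, exists f g : dpoly K n, [/\ eta g != 0, t i * eta g = eta f,
     forall x v, x \in msupp f -> v \in finsupp x -> (v.2 < l v.1)%N &
     forall x v, x \in msupp g -> v \in finsupp x -> (v.2 < l v.1)%N]) ->
  alg_independent iota t -> (d + \sum_i m i <= \sum_j l j)%N.
Proof.
move=> Aconst Asize Afree ratio indep.
pose F (x : {i : 'I_n & 'I_(m i)}) (j : 'I_n) : {poly K} :=
  iter (tagged x) (opD delta) (A (tag x) j).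
have szF x j : (size (F x j) <= l j)%N.
  rewrite /F; case: x => i k /=; have [->|Aij] := eqVneq (A i j) 0.
    by rewrite iter_opD0 size_poly0.
  rewrite -ltnS (leq_trans _ (Asize i j Aij)) // addnC.
  apply: (@leq_ltn_trans (k + size (A i j))); first exact: size_iter_opD.
  by rewrite ltn_add2r.
have Mfree : row_free (coefmx F l).
  apply: row_free_coefmx => // x xF.
  pose p i := \poly_(k < m i) (if insub k is Some k'
    then x (Tagged (fun i => 'I_(m i)) (k' : 'I_(m i))) else 0).
  have pE i (k : 'I_(m i)) : (p i)`_k = x (Tagged (fun i => 'I_(m i)) k).
    by rewrite coef_poly ltn_ord valK.
  have p0 : forall i, p i = 0.
    apply: Afree => j; apply: etrans (xF j).
    rewrite (eq_bigr (fun i => \sum_(k < m i) x (Tagged (fun i => 'I_(m i)) k) *: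
       F (Tagged (fun i => 'I_(m i)) k) j)); last first.
      move=> i _; rewrite (opmulEw _ _ (size_poly _ _)); apply: eq_bigr => k _.
      by rewrite -/(p i) pE.
    rewrite sig_big_dep; apply: eq_big => -[i k] //.
  by move=> [i k]; rewrite -pE p0 coef0.
pose y (b : 'I_#|{: {j : 'I_n & 'I_(l j)}}|) :=
  eta (dX K (tag (enum_val b), tagged (enum_val b) : nat)).
have rel a : exists b : K, \sum_j iota (coefmx F l a j) * y j = iota b.
  have [b bE] := Aconst (tag (enum_val a)) (tagged (enum_val a)).
  exists b; rewrite -bE (@rmorph_form_poly_widen _ _ _ eta _ l); last first.
    by move=> j; rewrite iter_form_D; exact: (szF (enum_val a)).
  apply: esym; rewrite sig_big_dep /= (reindex_onto (@enum_val _ _) (@enum_rank _)) /=.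
    apply: eq_big => [c|c _]; first by rewrite enum_valK eqxx.
    rewrite [coefmx F l a c]mxE iter_form_D.
    exact: erefl.
  by move=> c _; rewrite enum_rankK.
have [D [z [DE yz]]] := affine_parametrization Mfree rel.
have value (f : dpoly K n) :
    (forall x v, x \in msupp f -> v \in finsupp x -> (v.2 < l v.1)%N) ->
    exists B, poly_value iota z B (eta f).
  apply: (@dpoly_ind K n (fun f => exists B, poly_value iota z B (eta f))
    (fun v => v.2 < l v.1)%N).
  - by move=> c; exists 0%N; exact: (poly_valueC iota z).
  - move=> p q [B1 h1] [B2 h2]; exists (maxn B1 B2); rewrite rmorphD.
    apply: poly_valueD; [apply: poly_valueS h1|apply: poly_valueS h2].
      exact: leq_maxl.
    exact: leq_maxr.
  - move=> p [j r] /= hr [B h]; exists (B + 1)%N; rewrite rmorphM.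
    apply: poly_valueM => //.
    have := yz (enum_rank (Tagged (fun j => 'I_(l j)) (Ordinal hr))).
    by rewrite /y enum_rankK.
rewrite -!card_tagged_ord -DE leq_add2r.
apply: (alg_independent_le _ indep) => i.
have [f [g [g0 tg fl gl]]] := ratio i.
by exists (eta f), (eta g); split=> //; exact: value.
Qed.
End DimBound.

Lemma Posz_sum (I : finType) (Q : pred I) (F : I -> nat) :
  ((\sum_(i | Q i) F i)%N)%:Z = \sum_(i | Q i) (F i)%:Z.
Proof. exact: (big_morph Posz PoszD (erefl (0 : int))). Qed.

(** Here s i j is the size of an operator, that is 1 + its order, or 0 for the
    zero operator. The hypothesis is used for m i = N - a i and l j = N + b j,
    with a and b the dual variables of the weights w. *)
Lemma assignment_bound n (s : 'I_n -> 'I_n -> nat) (d N0 : nat) :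
  (forall m l : 'I_n -> nat, (forall j, N0 <= l j)%N ->
     (forall i j, s i j != 0%N -> (s i j + m i <= (l j).+1)%N) ->
     (d + \sum_i m i <= \sum_j l j)%N) ->
  exists rho : 'S_n, (forall i, s i (rho i) != 0%N) /\
    (d <= \sum_i (s i (rho i)).-1)%N.
Proof.
move=> bound; pose C := (\sum_i \sum_j s i j)%N.
(* The weight of a missing entry outweighs all the others together. *)
pose w i j : int := if s i j == 0%N then - (C.+1%:Z) else (s i j).-1%:Z.
have [rho [a [b [wab wrho]]]] := assignment_duality w.
pose N := (N0 + \sum_i `|a i| + \sum_j `|b j|)%N.
have aN i : (`|a i| <= N)%N.
  have : (`|a i| <= \sum_i `|a i|)%N by rewrite (bigD1 i) //= leq_addr.
  by rewrite /N; lia.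
have bN j : (N0 + `|b j| <= N)%N.
  have : (`|b j| <= \sum_j `|b j|)%N by rewrite (bigD1 j) //= leq_addr.
  by rewrite /N; lia.
pose m i := absz (N%:Z - a i); pose l j := absz (N%:Z + b j).
have mE i : (m i)%:Z = N%:Z - a i by have := aN i; rewrite /m; lia.
have lE j : (l j)%:Z = N%:Z + b j by have := bN j; rewrite /l; lia.
have dle : d%:Z <= \sum_i w i (rho i).
  have : (d + \sum_i m i <= \sum_j l j)%N.
    apply: bound => [j|i j sij]; first by have := bN j; have := lE j; lia.
    have := wab i j; rewrite /w (negPf sij); have := mE i; have := lE j.
    by move: sij; lia.
  rewrite -lez_nat PoszD !Posz_sum.
  rewrite (eq_bigr _ (fun i _ => mE i)) (eq_bigr _ (fun i _ => lE i)).
  rewrite (eq_bigr _ (fun i _ => wrho i)) !big_split /= sumrN.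
  rewrite [X in _ -> _ <= _ + X](_ : _ = \sum_j b j); last first.
    by rewrite [RHS](reindex_inj (@perm_inj _ rho)).
  rewrite !sumr_const.
  by move: (_ *+ _) (\sum_(i < n) a i) (\sum_(j < n) b j) => x y z; lia.
have wle i j : w i j <= (s i j)%:Z by rewrite /w; case: eqP => ?; lia.
(* A missing entry on rho would make the total weight negative. *)
have nz i : s i (rho i) != 0%N.
  apply: contraL dle => /eqP si0; rewrite -ltNge (bigD1 i) //= {1}/w si0 eqxx.
  have : \sum_(k | k != i) w k (rho k) <= C%:Z.
    apply: (@le_trans _ _ (\sum_(k | k != i) (s k (rho k))%:Z)).
      by apply: ler_sum.
    rewrite -Posz_sum lez_nat /C.
    rewrite [leqRHS](bigD1 i) //= (leq_trans _ (leq_addl _ _)) //.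
    by apply: leq_sum => k _; rewrite (bigD1 (rho k)) //= leq_addr.
  by move=> h; apply: (le_lt_trans (lerD (lexx _) h)); lia.
exists rho; split=> //; move: dle.
rewrite (eq_bigr (fun i => (s i (rho i)).-1%:Z)); last first.
  by move=> i _; rewrite /w (negPf (nz i)).
by rewrite -Posz_sum lez_nat.
Qed.

Lemma dord_ge (K : fieldType) n c (j : 'I_n) (u : dpoly K n) :
  linear_part u j != 0 -> (((size (linear_part u j)).-1%:Z)%:E <= dord c j u)%E.
Proof.
move=> uj; set r := _.-1.
have pu : pderiv (j, r) u != 0.
  have : u@_(ucm (j, r)) != 0 by rewrite -coef_linear_part -lead_coefE lead_coef_eq0.
  apply: contraNneq => p0.
  have := mcoeff_pderiv (j, r) u (onecm _).
  by rewrite p0 mcoeff0 mul0cm onecmE mulr1n => <-.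
by apply: (bigmax_sup (Ordinal (dbound_pderiv pu))).
Qed.

Theorem corollary8p3 (K : fieldType) (delta : K -> K)
    (hdelta : is_derivation delta) (hK : [pchar K] =i pred0)
    (n : nat) (u : 'I_n -> dpoly K n) (hu : forall i, dlinear (u i))
    (P : prime_idealr (dpoly K n))
    (hP : is_minimal_prime_over (diff_ideal_gen delta u) P)
    (d : nat) (hd : has_trdeg (base_map P) d) (c : convention) :
  ((Posz d)%:E <= jacobi_bound c u)%E.
Proof.
pose A i := linear_part (u i).
have eta0 f : (residue_map P f == 0) = (f \in P) := residue_map_eq0 P f.
have [[t indep] dmax] := hd.
have Afree (p : 'I_n -> {poly K}) :
    (forall j, \sum_i opmul delta (p i) (A i j) = 0) -> forall i, p i = 0.
  apply: (op_rows_free hdelta) => j.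
  apply: (component_torsion hdelta hu hP eta0 (d := d)) => t' /dmax.
  by rewrite ltnn.
have Aconst := residue_iter_linear_part hdelta hu hP eta0.
have /fin_all_exists[f /fin_all_exists[g fgP]] : forall i, exists f g,
    residue_map P g != 0 /\ t i * residue_map P g = residue_map P f.
  by move=> i; exact: residue_field_ratio.
have var_lt (h : dpoly K n) (x : {cmonom ('I_n * nat)%type}) v :
    x \in msupp h -> v \in finsupp x -> (v.2 < dbound h)%N.
  move=> xh vx; apply: (@leq_trans (\max_(v <- finsupp x) v.2.+1)).
    exact: (@leq_bigmax_seq _ (enum_fset (finsupp x)) xpredT
      (fun v : 'I_n * nat => v.2.+1) v vx isT).
  exact: (@leq_bigmax_seq _ (enum_fset (msupp h)) xpredT
    (fun x : {cmonom ('I_n * nat)%type} => \max_(v <- finsupp x) v.2.+1)%N x xh isT).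
(* All the variables in the fractions t i have order < N0. *)
pose N0 := (\sum_i (dbound (f i) + dbound (g i)))%N.
have fN i : (dbound (f i) <= N0)%N by rewrite /N0 (bigD1 i) //= -addnA leq_addr.
have gN i : (dbound (g i) <= N0)%N by rewrite /N0 (bigD1 i) //= -addnA addnCA leq_addr.
have [|rho [rho0 drho]] := @assignment_bound n (fun i j => size (A i j)) d N0.
  move=> m l lN0 Asize.
  apply: (transcendence_bound hdelta Aconst (t := t)) => // [i j Aij|i].
    by apply: Asize; rewrite size_poly_eq0.
  exists (f i), (g i); have [gi0 tg] := fgP i; split=> // x v xs vx.
    by apply: leq_trans (lN0 _); apply: leq_trans (fN i); exact: var_lt vx.
  by apply: leq_trans (lN0 _); apply: leq_trans (gN i); exact: var_lt vx.
apply: (@le_trans _ _ (\sum_(i < n) dord c (rho i) (u i))%E); last first.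
  by apply: (bigmax_sup rho).
apply: (@le_trans _ _ (\sum_(i < n) ((size (A i (rho i))).-1%:Z)%:E)%E).
  rewrite sumEFin lee_fin -Posz_sum lez_nat //.
by apply: lee_sum => i _; apply: dord_ge; rewrite -size_poly_eq0; exact: rho0.
Qed.
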